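(* Let $m>0$, $A=\begin{pmatrix}\alpha&\beta\\\gamma&\delta\end{pmatrix}\in\mathbb{C}^{2\times2}$, and let $z\in\mathbb{C}\setminus[0,+\infty)$ satisfy $$4-\det(A)+\frac{2i}{\mu(z)}\alpha+2i\mu(z)\delta\neq0.$$ For $c>0$ let $A_c=\begin{pmatrix}\frac{\alpha}{2mc}&\beta\\\gamma&2mc\,\delta\end{pmatrix}$. Then for all sufficiently large $c$, $z$ lies in the resolvent set of $D^{m,c}_{A_c}-mc^2$, and $$\lim_{c\to+\infty}\Big\|(D^{m,c}_{A_c}-mc^2-z)^{-1}-\begin{pmatrix}1&0\\0&0\end{pmatrix}\otimes(H_A-z)^{-1}\Big\|=0$$ in operator norm on $L^2(\mathbb{R};\mathbb{C}^2)$, where $\begin{pmatrix}1&0\\0&0\end{pmatrix}\otimes(H_A-z)^{-1}$ maps $(\psi_1,\psi_2)\mapsto((H_A-z)^{-1}\psi_1,0)$.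
   Context: Let $\sigma_1=\begin{pmatrix}0&1\\1&0\end{pmatrix}$, $\sigma_3=\begin{pmatrix}1&0\\0&-1\end{pmatrix}$. For $m\in\mathbb{R}$, $c>0$, $B\in\mathbb{C}^{2\times2}$, $D^{m,c}_B$ is the operator in $L^2(\mathbb{R};\mathbb{C}^2)$ with domain $\{\psi=\psi_-\oplus\psi_+\in H^1(\mathbb{R}_-;\mathbb{C}^2)\oplus H^1(\mathbb{R}_+;\mathbb{C}^2): (2i\sigma_1-B)\psi(0_+)=(2i\sigma_1+B)\psi(0_-)\}$ ($\psi(0_\pm)$ the one-sided traces) acting on each half-line by $\psi_\pm\mapsto -ic\sigma_1\psi_\pm'+mc^2\sigma_3\psi_\pm$. Branch convention: $\mathrm{Im}\sqrt{w}>0$ for $w\in\mathbb{C}\setminus[0,+\infty)$; $\mu(z)=\sqrt{2mz}$. $H_A$ is the operator in $L^2(\mathbb{R})$ with domain consisting of $\psi=\psi_-\oplus\psi_+\in H^2(\mathbb{R}_-)\oplus H^2(\mathbb{R}_+)$ such that $\psi'(0_+)-\psi'(0_-)=\alpha\frac{\psi(0_+)+\psi(0_-)}{2}-i\beta\frac{\psi'(0_+)+\psi'(0_-)}{2}$ and $\psi(0_+)-\psi(0_-)=-i\gamma\frac{\psi(0_+)+\psi(0_-)}{2}-\delta\frac{\psi'(0_+)+\psi'(0_-)}{2}$, acting by $H_A\psi=-\frac{1}{2m}\psi_-''\oplus-\frac{1}{2m}\psi_+''$. *)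

(* Defs.v *)
From mathcomp Require Import all_boot all_algebra.
From mathcomp Require Import all_classical all_reals all_analysis.
From mathcomp Require Export complex.
Import GRing.Theory Num.Theory.

Set Implicit Arguments.
Unset Strict Implicit.
Unset Printing Implicit Defensive.

Local Open Scope ring_scope.
Local Open Scope classical_set_scope.
Local Open Scope complex_scope.

Section Defs.
Context {R : realType}.
Local Notation C := R[i].
Local Notation leb := (@lebesgue_measure R).

Definition iC : C := Complex 0 1.

Definition csq (w : C) : R := complex.Re w ^+ 2 + complex.Im w ^+ 2.

Definition L2fun (f : R -> C) : Prop :=
  measurable_fun setT (fun x => complex.Re (f x)) /\
  measurable_fun setT (fun x => complex.Im (f x)) /\
  leb.-integrable setT (fun x => (csq (f x))%:E).

Definition L2sq (f : R -> C) : R := Rintegral leb setT (fun x => csq (f x)).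

Definition cint (A : set R) (g : R -> C) : C :=
  Complex (Rintegral leb A (fun x => complex.Re (g x)))
          (Rintegral leb A (fun x => complex.Im (g x))).

Definition L2vec (n : nat) (f : R -> 'cV[C]_n) : Prop :=
  forall i : 'I_n, L2fun (fun x => f x i 0).

Definition L2norm (n : nat) (f : R -> 'cV[C]_n) : R :=
  Num.sqrt (\sum_(i < n) L2sq (fun x => f x i 0)).

Definition L2norm_s (f : R -> C) : R := Num.sqrt (L2sq f).

(** psi restricted to R_- and to R_+ belongs to H^1(R_-) resp. H^1(R_+),
    with (weak) derivative g on R \ {0} and one-sided traces
    psi(0+) = ap, psi(0-) = am:  psi is absolutely continuous on each
    closed half-line, psi and psi' are square integrable. *)
Definition H1s (psi g : R -> C) (ap am : C) : Prop :=
  L2fun psi /\ L2fun g /\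
  (forall x, 0 < x -> psi x = ap + cint `]0, x[ g) /\
  (forall x, x < 0 -> psi x = am - cint `]x, 0[ g).

Definition H1v (n : nat) (psi g : R -> 'cV[C]_n) (ap am : 'cV[C]_n) : Prop :=
  forall i : 'I_n, H1s (fun x => psi x i 0) (fun x => g x i 0) (ap i 0) (am i 0).

Definition sigma1 : 'M[C]_2 := \matrix_(i < 2, j < 2) ((i != j)%:R : C).
Definition sigma3 : 'M[C]_2 :=
  \matrix_(i < 2, j < 2) (if i == j then (if val i == 0%N then 1 else -1) else 0 : C).

(** Graph of  D^{m,c}_B - m c^2 - z  :  psi is in dom D^{m,c}_B and
    (D^{m,c}_B - m c^2 - z) psi = f  (a.e.). *)
Definition Dirac_graph (m c : R) (B : 'M[C]_2) (z : C)
    (psi f : R -> 'cV[C]_2) : Prop :=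
  exists (g : R -> 'cV[C]_2) (ap am : 'cV[C]_2),
    H1v psi g ap am /\
    ((2%:R * iC) *: sigma1 - B) *m ap = ((2%:R * iC) *: sigma1 + B) *m am /\
    {ae leb, forall x,
       (- iC * c%:C) *: (sigma1 *m g x) + (m * c ^+ 2)%:C *: (sigma3 *m psi x)
       - ((m * c ^+ 2)%:C + z) *: psi x = f x}.

(** Graph of  H_A - z  with A = (alpha beta; gamma delta):  psi is in
    dom H_A (psi, psi', psi'' in L^2 on each half-line, with traces
    psi(0+-) = ap, am and psi'(0+-) = bp, bm satisfying the two
    interface conditions) and (H_A - z) psi = f (a.e.). *)
Definition HA_graph (m : R) (al be ga de z : C) (psi f : R -> C) : Prop :=
  exists (g h : R -> C) (ap am bp bm : C),
    H1s psi g ap am /\ H1s g h bp bm /\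
    bp - bm = al * ((ap + am) / 2%:R) - iC * be * ((bp + bm) / 2%:R) /\
    ap - am = - iC * ga * ((ap + am) / 2%:R) - de * ((bp + bm) / 2%:R) /\
    {ae leb, forall x, - (2%:R * m)%:C^-1 * h x - z * psi x = f x}.

(** z is in the resolvent set of T, given the graph G of T - z:
    T - z maps its domain bijectively (modulo a.e. equality) onto L^2 and
    the inverse is bounded. *)
Definition in_resolvent (n : nat) (G : (R -> 'cV[C]_n) -> (R -> 'cV[C]_n) -> Prop) : Prop :=
  (forall f, L2vec f -> exists psi, G psi f) /\
  (forall psi1 psi2 f, G psi1 f -> G psi2 f -> {ae leb, forall x, psi1 x = psi2 x}) /\
  (exists K : R, forall psi f, G psi f -> L2norm psi <= K * L2norm f).

Definition in_resolvent_s (G : (R -> C) -> (R -> C) -> Prop) : Prop :=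
  (forall f, L2fun f -> exists psi, G psi f) /\
  (forall psi1 psi2 f, G psi1 f -> G psi2 f -> {ae leb, forall x, psi1 x = psi2 x}) /\
  (exists K : R, forall psi f, G psi f -> L2norm_s psi <= K * L2norm_s f).

Definition mu (m : R) (z : C) : C :=
  xget 0 [set w : C | w ^+ 2 = (2%:R * m)%:C * z /\ 0 < complex.Im w].

Definition Amat (al be ga de : C) : 'M[C]_2 :=
  \matrix_(i < 2, j < 2)
    (if val i == 0%N then (if val j == 0%N then al else be)
     else (if val j == 0%N then ga else de)).

Definition Ac (m c : R) (al be ga de : C) : 'M[C]_2 :=
  Amat (al / (2%:R * m * c)%:C) be ga ((2%:R * m * c)%:C * de).

Definition embed1 (phi : R -> C) : R -> 'cV[C]_2 :=
  fun x => \col_(i < 2) (if val i == 0%N then phi x else 0).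

End Defs.

(* Main.v *)
(** With [a = 1 + z / (2 m c^2)], [u1 = psi_1] and [u2 = 2 i m c psi_2], the
    equation [(D - m c^2 - z) psi = f] becomes the system
      [u1' = a u2 + (i / c) f_2],  [u2' = - 2 m z u1 - 2 m f_1],
    and the interface condition for [A_c] becomes exactly the one of [H_A] for
    [(u1, u2)]; the equation [(H_A - z) u1 = f_1] is the case [a = 1], [f_2 = 0].
    So it is enough to bound the solutions of [u1' = u2 + h1],
    [u2' = - k^2 u1 + h2] ([k = mu z]) by [h1, h2]: moving [(a - 1) u2] into [h1]
    then gives uniform bounds and the [O(1/c)] convergence.

    The combinations [p = u2 + i k u1] and [q = u2 - i k u1] solve decoupled scalar
    equations [p' = i k p + P], [q' = - i k q + Q].  On each half-line one of them
    is decaying, with arbitrary trace at [0], and the other one is growing, with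
    trace determined by the right-hand side; energy identities for [|p|^2] bound
    both.  The two remaining traces solve a 2 x 2 linear system of determinant
    [- i / (8 k) (4 - det A + 2 i alpha / k + 2 i k delta)]. *)

Require Import Defs.
From mathcomp Require Import all_boot all_order all_algebra.
From mathcomp Require Import all_classical all_reals all_analysis.
From mathcomp Require Import measurable_realfun complex.
From mathcomp Require Import ring lra.
Import Order.TTheory GRing.Theory Num.Theory.
Import numFieldNormedType.Exports.
Set Implicit Arguments.
Unset Strict Implicit.
Unset Printing Implicit Defensive.
Local Open Scope ring_scope.
Local Open Scope classical_set_scope.
Local Open Scope complex_scope.

Local Notation Re := complex.Re.
Local Notation Im := complex.Im.

(** * Products of indefinite integrals *)

Section RealIntegral.
Context {R : realType}.
Local Notation leb := (@lebesgue_measure R).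
Implicit Types F G : R -> R.

(** The graphs encode [H^1] by indefinite integrals of a derivative that is merely square
    integrable, so no pointwise product rule is available. Integration by parts is obtained from
    Fubini on a triangle, and whatever differentiates a product (the identity for [|p|^2], variation
    of constants) rests on it. Absorbing [(a - 1) u2] into [h1] yields bounds but not existence,
    since [h1] would then contain the unknown. Instead of a fixed point, a rescaling by a square
    root of [a] reduces the perturbed system to an unperturbed one with nearby parameters, whose
    determinant is still nonzero for [a] near [1]. The resolvent bound concerns every [f] related to
    [psi] by the graph; such an [f] is only almost everywhere equal to an [L^2] function and may
    fail to be measurable. Hence the representatives [F1], [F2] in [perturbed] and a comparison of
    integrals without measurability. Squared norms are used throughout, so that the estimates become
    linear real arithmetic; square roots are taken only at the end. *)

Lemma integrable_lin (A : set (measurableTypeR R)) F G (a b : R) : measurable A ->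
  leb.-integrable A (EFin \o F) -> leb.-integrable A (EFin \o G) ->
  leb.-integrable A (EFin \o (fun x => a * F x + b * G x)).
Proof.
move=> mA iF iG.
have := integrableD mA (integrableZl mA a iF) (integrableZl mA b iG).
exact: eq_integrable.
Qed.

Lemma Rintegral_lin (A : set (measurableTypeR R)) F G (a b : R) : measurable A ->
  leb.-integrable A (EFin \o F) -> leb.-integrable A (EFin \o G) ->
  Rintegral leb A (fun x => a * F x + b * G x) =
  a * Rintegral leb A F + b * Rintegral leb A G.
Proof.
move=> mA iF iG; rewrite RintegralD ?RintegralZl//.
  have := integrableZl mA a iF; exact: eq_integrable.
have := integrableZl mA b iG; exact: eq_integrable.
Qed.

Lemma Rprimitive_diff F (t x : R) : 0 < t -> t < x ->
  leb.-integrable `]0, x[ (EFin \o F) ->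
  Rintegral leb `]t, x[ F = Rintegral leb `]0, x[ F - Rintegral leb `]0, t[ F.
Proof.
move=> t0 tx iF.
have -> : Rintegral leb `]0, t[ F = Rintegral leb `]0, t] F.
  rewrite Rintegral_itv_bndo_bndc//.
  apply: integrableS iF => //.
  by apply: subset_itvl; rewrite bnd_simp ltW.
by rewrite Rintegral_itvB// bnd_simp ltW.
Qed.

Lemma integral_scale_restrict (J : set R) (c : R) G : measurable J ->
  leb.-integrable J (EFin \o G) ->
  (\int[leb]_t (c * (G \_ J) t)%:E = (c * Rintegral leb J G)%:E)%E.
Proof.
move=> mJ iG.
have iG' : leb.-integrable setT (EFin \o (G \_ J)).
  by rewrite -restrict_EFin -integrable_mkcond.
under eq_integral do rewrite EFinM.
rewrite integralZl//= EFinM; congr (_ * _)%E.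
rewrite /Rintegral fineK; last exact: integrable_fin_num.
rewrite [RHS]integral_mkcond; apply: eq_integral => t _.
by rewrite !patchE; case: ifP.
Qed.

(** The function [F(s) G(t)] on the triangle [0 < t < s < x], extended by zero. Integrating out [t]
    leaves [F(s)] times the primitive of [G]; integrating out [s] leaves [G(t)] times the integral
    of [F] over []t, x[]. *)
Definition triangle_kernel (x : R) F G (p : R * R) : \bar R :=
  (if p.2 < p.1 then (F \_ `]0, x[) p.1 * (G \_ `]0, x[) p.2 else 0)%:E.

(** Dropping the constraint [t < s] dominates the kernel by a tensor product, whose iterated
    integral factors into two finite [L^1] norms. *)
Lemma integrable_triangle_kernel F G (x : R) :
  leb.-integrable `]0, x[ (EFin \o F) -> leb.-integrable `]0, x[ (EFin \o G) ->
  (leb \x leb)%E.-integrable setT (triangle_kernel x F G).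
Proof.
move=> iF iG.
set I := `]0, x[%classic.
have mI : measurable I by exact: measurable_itv.
pose F' := F \_ I; pose G' := G \_ I; pose K := triangle_kernel x F G.
have iF' : leb.-integrable setT (EFin \o F').
  by rewrite /F' -restrict_EFin -integrable_mkcond.
have iG' : leb.-integrable setT (EFin \o G').
  by rewrite /G' -restrict_EFin -integrable_mkcond.
have mF' : measurable_fun setT F' by have /measurable_EFinP := measurable_int _ iF'.
have mG' : measurable_fun setT G' by have /measurable_EFinP := measurable_int _ iG'.
have mK : measurable_fun setT K.
  apply/measurable_EFinP; apply: measurable_fun_ifT.
  - exact: measurable_fun_ltr.
  - apply: measurable_funM.
    + exact: measurableT_comp.
    + exact: measurableT_comp.
  - exact: measurable_cst.
apply/integrable12ltyP => //.
apply: (@le_lt_trans _ _ (\int[leb]_s (`|F' s|%:E * (\int[leb]_t `|G' t|%:E)))%E).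
  apply: ge0_le_integral => //.
  - by move=> s _; apply: integral_ge0 => t _; exact: abse_ge0.
  - apply: (@measurable_fun_fubini_tonelli_F _ _ _ _ R leb (abse \o K)) => //=.
    exact: measurableT_comp.
  - apply: emeasurable_funM => //.
    exact/measurable_EFinP/measurableT_comp.
  - move=> s _; rewrite -ge0_integralZl//; last first.
      exact/measurable_EFinP/measurableT_comp.
    apply: ge0_le_integral => //.
    + by apply: measurableT_comp => //; apply: measurableT_comp => //.
    + apply: emeasurable_funM => //; exact/measurable_EFinP/measurableT_comp.
    + move=> t _; rewrite /K /= -EFinM lee_fin; case: ifP => _.
        by rewrite normrM.
      by rewrite normr0 mulr_ge0.
have fG : (\int[leb]_t `|G' t|%:E)%E \is a fin_num.
  apply: integrable_fin_num => //=.
  by move/integrable_abse : iG'.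
rewrite -(fineK fG) ge0_integralZr//=.
- rewrite lte_mul_pinfty//.
  + exact: integral_ge0.
  + have := integrable_fin_num measurableT (integrable_abse iF'); exact.
  + exact: ltey.
- exact/measurable_EFinP/measurableT_comp.
- by rewrite lee_fin fine_ge0// integral_ge0.
Qed.

Lemma fubini_triangle_kernel F G (x s : R) :
  leb.-integrable `]0, x[ (EFin \o G) ->
  fubini_F leb (triangle_kernel x F G) s =
  ((fun s => F s * Rintegral leb `]0, s[ G) \_ `]0, x[ s)%:E.
Proof.
move=> iG; rewrite patchE; set I := `]0, x[%classic.
have mI : measurable I by exact: measurable_itv.
case: ifPn => [/set_mem Is|/negP nIs]; last first.
  rewrite /fubini_F integral0_eq// => t _.
  rewrite /triangle_kernel /= patchE memNset ?mul0r ?if_same//.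
  by move=> Is; apply: nIs; rewrite inE.
have /andP[s0 sx] : 0 < s < x by move: Is; rewrite /I /= in_itv.
rewrite /fubini_F -integral_scale_restrict//; last first.
  by apply: integrableS iG => //; apply: subset_itvl; rewrite bnd_simp ltW.
apply: eq_integral => t _; rewrite /triangle_kernel /= !patchE (mem_set Is).
congr EFin.
case: (ltP t s) => ts; last first.
  by rewrite memNset ?mulr0//= in_itv/= => /andP[_]; rewrite ltNge ts.
congr (_ * _); case: (ltP 0 t) => t0.
  have It : I t by rewrite /I /= in_itv/= t0 (lt_trans ts).
  have Jt : `]0, s[%classic t by rewrite /= in_itv/= t0.
  by rewrite (mem_set It) (mem_set Jt).
have nIt : ~ I t by rewrite /I /= in_itv/= ltNge t0.
have nJt : ~ `]0, s[%classic t by rewrite /= in_itv/= ltNge t0.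
by rewrite (memNset nIt) (memNset nJt).
Qed.

(** Fubini already says that partial integrals of an integrable kernel are integrable; no continuity
    or bound of the primitive is needed. *)
Lemma Rprimitive_mul_integrable F G (x : R) :
  leb.-integrable `]0, x[ (EFin \o F) -> leb.-integrable `]0, x[ (EFin \o G) ->
  leb.-integrable `]0, x[ (EFin \o (fun s => F s * Rintegral leb `]0, s[ G)).
Proof.
move=> iF iG.
have : leb.-integrable `]0, x[ (fubini_F leb (triangle_kernel x F G)).
  by apply: integrableS (integrable_fubini_F (integrable_triangle_kernel iF iG)).
apply: eq_integrable => // s sI; rewrite fubini_triangle_kernel// patchE.
by rewrite sI.
Qed.

(** Integration by parts for two functions that are only integrable: the product rule on which all
    energy identities depend. *)
Lemma Rprimitive_mul F G (x : R) :
  leb.-integrable `]0, x[ (EFin \o F) -> leb.-integrable `]0, x[ (EFin \o G) ->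
  [/\ leb.-integrable `]0, x[ (EFin \o (fun s => F s * Rintegral leb `]0, s[ G)),
      leb.-integrable `]0, x[ (EFin \o (fun s => Rintegral leb `]0, s[ F * G s)) &
      Rintegral leb `]0, x[ F * Rintegral leb `]0, x[ G =
      Rintegral leb `]0, x[ (fun s => F s * Rintegral leb `]0, s[ G) +
      Rintegral leb `]0, x[ (fun s => Rintegral leb `]0, s[ F * G s)].
Proof.
move=> iF iG.
set I := `]0, x[%classic.
have mI : measurable I by exact: measurable_itv.
set K := triangle_kernel x F G.
have iK : (leb \x leb)%E.-integrable setT K by exact: integrable_triangle_kernel.
have GI t : I t -> fubini_G leb K t =
    (G t * (Rintegral leb `]0, x[ F - Rintegral leb `]0, t[ F))%:E.
  move=> It; have /andP[t0 tx] : 0 < t < x by move: It; rewrite /I /= in_itv.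
  rewrite -Rprimitive_diff// /fubini_G -integral_scale_restrict//; last first.
    by apply: integrableS iF => //; apply: subset_itvr; rewrite bnd_simp ltW.
  apply: eq_integral => s _; rewrite /K /triangle_kernel /= !patchE (mem_set It).
  congr EFin.
  case: (ltP t s) => ts; last first.
    by rewrite [in RHS]memNset ?mulr0//= in_itv/= => /andP[]; rewrite ltNge ts.
  rewrite mulrC; congr (_ * _); case: (ltP s x) => sx.
    have Is : I s by rewrite /I /= in_itv/= sx (lt_trans t0).
    have Js : `]t, x[%classic s by rewrite /= in_itv/= ts.
    by rewrite (mem_set Is) (mem_set Js).
  have nIs : ~ I s by rewrite /I /= in_itv/= [s < x]ltNge sx andbF.
  have nJs : ~ `]t, x[%classic s by rewrite /= in_itv/= [s < x]ltNge sx andbF.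
  by rewrite (memNset nIs) (memNset nJs).
have G0 t : ~ I t -> fubini_G leb K t = 0%E.
  move=> nIt; rewrite /fubini_G integral0_eq// => s _.
  by rewrite /K /triangle_kernel /= [X in _ * X]patchE memNset// mulr0 if_same.
have iFV := Rprimitive_mul_integrable iF iG.
have iUG : leb.-integrable I (EFin \o (fun s => Rintegral leb `]0, s[ F * G s)).
  have := Rprimitive_mul_integrable iG iF; apply: eq_integrable => // s _ /=.
  by rewrite mulrC.
have iGx : leb.-integrable I (EFin \o (fun s => G s * Rintegral leb `]0, x[ F)).
  have := integrable_lin (Rintegral leb I F) 0 mI iG iG.
  by apply: eq_integrable => // s _ /=; rewrite mul0r addr0 mulrC.
have iGU : leb.-integrable I (EFin \o (fun s => G s *
    (Rintegral leb `]0, x[ F - Rintegral leb `]0, s[ F))).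
  have := integrable_lin 1 (- 1) mI iGx iUG; apply: eq_integrable => // s _ /=.
  by congr EFin; rewrite mul1r mulN1r; ring.
split=> //.
(* Exchanging the order of integration turns the first term into the integral of
   [G(s) (U(x) - U(s))], with [U] the primitive of [F]; the [U(s)] part cancels the second term. *)
have -> : Rintegral leb I (fun s => F s * Rintegral leb `]0, s[ G) =
    Rintegral leb I (fun s => G s *
    (Rintegral leb `]0, x[ F - Rintegral leb `]0, s[ F)).
  rewrite /Rintegral; congr fine.
  transitivity (\int[leb]_s fubini_F leb K s)%E.
    rewrite integral_mkcond; apply: eq_integral => s _.
    by rewrite fubini_triangle_kernel// !patchE; case: ifP.
  transitivity (\int[leb]_t fubini_G leb K t)%E; first exact: (Fubini iK).
  rewrite [RHS]integral_mkcond; apply: eq_integral => s _; rewrite patchE.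
  by case: ifPn => [/set_mem/GI->//|/negP nI]; rewrite G0// => /mem_set.
rewrite -RintegralD// mulrC -RintegralZr//.
by apply: eq_Rintegral => s _; ring.
Qed.
End RealIntegral.

(** * Complex-valued integrals and primitives *)

Section ComplexParts.
Context {R : realType}.
Implicit Types x y : R[i].

Lemma cReD x y : Re (x + y) = Re x + Re y. Proof. by case: x; case: y. Qed.
Lemma cImD x y : Im (x + y) = Im x + Im y. Proof. by case: x; case: y. Qed.
Lemma cReN x : Re (- x) = - Re x. Proof. by case: x. Qed.
Lemma cImN x : Im (- x) = - Im x. Proof. by case: x. Qed.
Lemma cReM x y : Re (x * y) = Re x * Re y - Im x * Im y.
Proof. by case: x; case: y. Qed.
Lemma cImM x y : Im (x * y) = Re x * Im y + Im x * Re y.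
Proof. by case: x; case: y. Qed.

Definition cReImE := (cReD, cImD, cReN, cImN, cReM, cImM).

Lemma complex_eq x y : Re x = Re y -> Im x = Im y -> x = y.
Proof. by case: x => ? ?; case: y => ? ? /= -> ->. Qed.

Lemma csq_ge0 x : 0 <= csq x.
Proof. by rewrite /csq addr_ge0 ?sqr_ge0. Qed.

Lemma csqM x y : csq (x * y) = csq x * csq y.
Proof. by rewrite /csq !cReImE; ring. Qed.

Lemma csqN x : csq (- x) = csq x.
Proof. by rewrite /csq !cReImE; ring. Qed.

Lemma csqD_le x y : csq (x + y) <= 2 * csq x + 2 * csq y.
Proof.
rewrite /csq !cReImE -subr_ge0.
have -> : 2 * (Re x ^+ 2 + Im x ^+ 2) + 2 * (Re y ^+ 2 + Im y ^+ 2) -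
  ((Re x + Re y) ^+ 2 + (Im x + Im y) ^+ 2) =
  (Re x - Re y) ^+ 2 + (Im x - Im y) ^+ 2 by ring.
by rewrite addr_ge0 ?sqr_ge0.
Qed.

Lemma csq_real (r : R) : csq r%:C = r ^+ 2.
Proof. by rewrite /csq /= expr0n addr0. Qed.

Lemma csq_gt0 x : x != 0 -> 0 < csq x.
Proof.
move=> x0; rewrite lt_neqAle csq_ge0 andbT; apply: contra x0; rewrite eq_sym.
case: x => a b; rewrite /csq /= paddr_eq0 ?sqr_ge0// !sqrf_eq0.
by move=> /andP[/eqP -> /eqP ->].
Qed.

Lemma sqr_Im_le_csq x : Im x ^+ 2 <= csq x.
Proof. by rewrite /csq lerDr sqr_ge0. Qed.

Lemma csq1 : csq (1 : R[i]) = 1.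
Proof. by rewrite /csq /= expr1n expr0n addr0. Qed.

Lemma csq0 : csq (0 : R[i]) = 0.
Proof. by rewrite /csq /= expr0n addr0. Qed.

Lemma csqV x : csq x^-1 = (csq x)^-1.
Proof.
have [->|x0] := eqVneq x 0; first by rewrite invr0 /csq /= expr0n addr0 invr0.
have c0 : csq x != 0 by rewrite gt_eqF// csq_gt0.
by apply: (mulIf c0); rewrite -csqM !mulVf// /csq /= expr1n expr0n addr0.
Qed.

Lemma csq_iC : csq (@iC R) = 1.
Proof. by rewrite /csq /= expr0n expr1n add0r. Qed.

End ComplexParts.

Section ComplexIntegral.
Context {R : realType}.
Local Notation C := R[i].
Local Notation leb := (@lebesgue_measure R).
Implicit Types (f g : R -> C) (A : set (measurableTypeR R)).

Definition cmeas f := measurable_fun setT (fun x => Re (f x)) /\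
  measurable_fun setT (fun x => Im (f x)).

Definition cintegrable A f := leb.-integrable A (fun x => (Re (f x))%:E) /\
  leb.-integrable A (fun x => (Im (f x))%:E).

Lemma cmeas_cst (c : C) : cmeas (fun=> c).
Proof. by split; exact: measurable_cst. Qed.

Lemma cmeasD f g : cmeas f -> cmeas g -> cmeas (fun x => f x + g x).
Proof.
move=> [f1 f2] [g1 g2]; split.
  by under eq_fun do rewrite cReD; exact: measurable_funD.
by under eq_fun do rewrite cImD; exact: measurable_funD.
Qed.

Lemma cmeasM f g : cmeas f -> cmeas g -> cmeas (fun x => f x * g x).
Proof.
move=> [f1 f2] [g1 g2]; split.
  under eq_fun do rewrite cReM.
  by apply: measurable_funB; exact: measurable_funM.
under eq_fun do rewrite cImM.
by apply: measurable_funD; exact: measurable_funM.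
Qed.

Lemma cmeas_opp f : cmeas f -> cmeas (fun x => f (- x)).
Proof.
by move=> [f1 f2]; split;
  [apply: (measurableT_comp f1)|apply: (measurableT_comp f2)].
Qed.

Lemma cmeas_if (P : R -> bool) f g : measurable_fun setT P ->
  cmeas f -> cmeas g -> cmeas (fun x => if P x then f x else g x).
Proof.
move=> mP [f1 f2] [g1 g2]; split.
  under eq_fun do rewrite (fun_if (@complex.Re R)).
  exact: measurable_fun_ifT.
under eq_fun do rewrite (fun_if (@complex.Im R)).
exact: measurable_fun_ifT.
Qed.

Lemma measurable_csq f : cmeas f -> measurable_fun setT (fun x => csq (f x)).
Proof.
by move=> [f1 f2]; apply: measurable_funD; exact: measurable_funX.
Qed.

Lemma eq_cint A f g : (forall x, A x -> f x = g x) -> cint A f = cint A g.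
Proof.
move=> fg; congr Complex; apply: eq_Rintegral => x; rewrite inE => /fg ->//.
Qed.

Lemma eq_cintegrable A f g : measurable A -> (forall x, A x -> f x = g x) ->
  cintegrable A f -> cintegrable A g.
Proof.
move=> mA fg [f1 f2]; split.
  by apply: eq_integrable f1 => // x; rewrite inE => /fg ->.
by apply: eq_integrable f2 => // x; rewrite inE => /fg ->.
Qed.

Lemma cintegrableS A (B : set (measurableTypeR R)) f : measurable A -> measurable B -> B `<=` A ->
  cintegrable A f -> cintegrable B f.
Proof. by move=> mA mB BA [f1 f2]; split; apply: integrableS BA _. Qed.

Lemma cintegrableD A f g : measurable A -> cintegrable A f -> cintegrable A g ->
  cintegrable A (fun x => f x + g x).
Proof.
move=> mA [f1 f2] [g1 g2]; split.
  have := integrable_lin 1 1 mA f1 g1; apply: eq_integrable => // x _ /=.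
  by rewrite cReD !mul1r.
have := integrable_lin 1 1 mA f2 g2; apply: eq_integrable => // x _ /=.
by rewrite cImD !mul1r.
Qed.

Lemma cintegrableZ A f (c : C) : measurable A -> cintegrable A f ->
  cintegrable A (fun x => c * f x).
Proof.
move=> mA [f1 f2]; split.
  have := integrable_lin (Re c) (- Im c) mA f1 f2; apply: eq_integrable => // x _ /=.
  by rewrite cReM mulNr.
have := integrable_lin (Re c) (Im c) mA f2 f1; apply: eq_integrable => // x _ /=.
by rewrite cImM.
Qed.

Lemma cintD A f g : measurable A -> cintegrable A f -> cintegrable A g ->
  cint A (fun x => f x + g x) = cint A f + cint A g.
Proof.
move=> mA [f1 f2] [g1 g2]; apply: complex_eq; rewrite cReImE /=.
  by rewrite -RintegralD//; apply: eq_Rintegral => x _; rewrite cReD.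
by rewrite -RintegralD//; apply: eq_Rintegral => x _; rewrite cImD.
Qed.

Lemma cintZ A f (c : C) : measurable A -> cintegrable A f ->
  cint A (fun x => c * f x) = c * cint A f.
Proof.
move=> mA [f1 f2]; apply: complex_eq; rewrite cReImE /=.
  rewrite -mulNr -Rintegral_lin//; apply: eq_Rintegral => x _.
  by rewrite cReM mulNr.
by rewrite -Rintegral_lin//; apply: eq_Rintegral => x _; rewrite cImM.
Qed.

Lemma cint_setU A (B : set (measurableTypeR R)) f : measurable A -> measurable B ->
  cintegrable (A `|` B) f -> [disjoint A & B] ->
  cint (A `|` B) f = cint A f + cint B f.
Proof.
move=> mA mB [f1 f2] AB; apply: complex_eq; rewrite cReImE /=;
  exact: Rintegral_setU.
Qed.

End ComplexIntegral.

(** * Reflection of integrals at the origin *)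

Section Reflection.
Context {R : realType}.
Local Notation leb := (@lebesgue_measure R).

(** Lebesgue measure is its own pushforward under negation. This lets the left half-line be treated
    as a second copy of the right one. *)
Lemma ge0_integral_reflect (A : set (measurableTypeR R)) (f : R -> \bar R) :
  measurable A -> measurable_fun setT f -> (forall x, (0 <= f x)%E) ->
  (\int[leb]_(x in -%R @^-1` A) f (- (x : R))%R = \int[leb]_(x in A) f x)%E.
Proof.
move=> mA mf f0; rewrite -(ge0_integral_pushforward
  (phi := (-%R : measurableTypeR R -> measurableTypeR R)))//=; last first.
  exact: measurable_funS mf.
by apply: eq_measure_integral => //= B mB BA; exact: lebesgue_measureN.
Qed.

Lemma integral_reflect (A : set (measurableTypeR R)) (f : R -> \bar R) :
  measurable A -> measurable_fun setT f ->
  (\int[leb]_(x in -%R @^-1` A) f (- (x : R))%R = \int[leb]_(x in A) f x)%E.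
Proof.
move=> mA mf; rewrite integralE [RHS]integralE; congr (_ - _)%E.
  rewrite -(ge0_integral_reflect mA (measurable_funepos mf))//.
  by under eq_integral do rewrite (funepos_comp f -%R).
rewrite -(ge0_integral_reflect mA (measurable_funeneg mf))//.
by under eq_integral do rewrite (funeneg_comp f -%R).
Qed.

Lemma cint_reflect (A : set (measurableTypeR R)) (f : R -> R[i]) :
  measurable A -> cmeas f ->
  cint (-%R @^-1` A) (fun x => f (- x)) = cint A f.
Proof.
move=> mA [f1 f2]; congr Complex; rewrite /Rintegral; congr fine.
  by rewrite (integral_reflect mA (f := EFin \o (fun x => Re (f x))))//;
    exact/measurable_EFinP.
by rewrite (integral_reflect mA (f := EFin \o (fun x => Im (f x))))//;
  exact/measurable_EFinP.
Qed.

End Reflection.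

(** * Primitives on the right half-line and their product rule *)

Section HalfLine.
Context {R : realType}.
Local Notation C := R[i].
Local Notation leb := (@lebesgue_measure R).
Local Notation half := (`]0, +oo[%classic : set (measurableTypeR R)).
Implicit Types (f g u v : R -> C) (F : R -> R) (X : R).

(** Monotone convergence. The bound is asked only for arbitrarily large [X], not for all:
    [growth_bound] controls the solution only at selected points. *)
Lemma integrable_ge0_half F (B : R) : measurable_fun setT F ->
  (forall x, 0 <= F x) ->
  (forall Y, exists2 X, Y < X & leb.-integrable `]0, X[ (EFin \o F) /\
     Rintegral leb `]0, X[ F <= B) ->
  leb.-integrable half (EFin \o F) /\ Rintegral leb half F <= B.
Proof.
move=> mF F0 HB.
pose I (n : nat) : set (measurableTypeR R) := `]0, n%:R[%classic.
have mI n : measurable (I n) by exact: measurable_itv.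
have bI : \bigcup_n I n = half.
  apply/seteqP; split=> [x [n _]|x]; rewrite /I /= !in_itv/=.
    by move=> /andP[->].
  rewrite andbT => x0; exists (Num.truncn x).+1 => //=.
  by rewrite in_itv/= x0 truncnS_gt.
have nI : nondecreasing_seq I.
  move=> m n mn; rewrite subsetEset; apply: subset_itvl.
  by rewrite bnd_simp ler_nat.
have mEF (A : set (measurableTypeR R)) : measurable_fun A (EFin \o F).
  by apply: measurable_funTS; exact/measurable_EFinP.
have leB n : (\int[leb]_(x in I n) (F x)%:E <= B%:E)%E.
  have [X nX [iX XB]] := HB n%:R.
  apply: (@le_trans _ _ (\int[leb]_(x in `]0%R, X[) (F x)%:E)%E).
    apply: ge0_subset_integral => //.
    - by move=> x _; rewrite /= lee_fin.
    - by apply: subset_itvl; rewrite bnd_simp ltW.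
  rewrite -[leLHS]fineK; last exact: integrable_fin_num.
  by rewrite lee_fin.
have hB : (\int[leb]_(x in half) (F x)%:E <= B%:E)%E.
  rewrite -bI.
  have cv := @ge0_nondecreasing_set_cvg_integral _ _ R I (EFin \o F) leb nI mI
    (fun i => mEF (I i)) (fun i x _ => (F0 x : (0 <= (EFin \o F) x)%E)).
  rewrite -(cvg_lim _ cv)//; apply: lime_le.
    by apply/cvg_ex; eexists; exact: cv.
  by apply: nearW => n; exact: leB.
have ih : leb.-integrable half (EFin \o F).
  apply/integrableP; split=> //.
  under eq_integral do rewrite /= ger0_norm//.
  exact: le_lt_trans hB (ltry _).
split=> //; rewrite -lee_fin fineK//.
exact: integrable_fin_num.
Qed.

Lemma integrable_cst_itv (a b r : R) : leb.-integrable `]a, b[ (EFin \o cst r).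
Proof.
apply: measurable_bounded_integrable => //.
- rewrite [X in (X < _)%E](_ : _ = lebesgue_measure `]a, b[%classic)//.
  by rewrite lebesgue_measure_itv/=; case: ifP => _; rewrite ?ltry// -EFinB ltry.
- by exists `|r|; split; [exact: num_real|move=> y ry x _ /=; exact: ltW].
Qed.

Lemma le_integrableR (A : set (measurableTypeR R)) (F G : R -> R) : measurable A ->
  measurable_fun setT F -> (forall x, A x -> `|F x| <= G x) ->
  leb.-integrable A (EFin \o G) -> leb.-integrable A (EFin \o F).
Proof.
move=> mA mF FG iG; apply: le_integrable iG => //.
  by apply: measurable_funTS; exact/measurable_EFinP.
by move=> x Ax; rewrite /= lee_fin (le_trans (FG _ Ax))// ler_norm.
Qed.

(** Absolute continuity on the closed half-line with weak derivative [g] and trace [a]. Only local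
    integrability is built in, so growing exponentials qualify; values of [u] at [x <= 0] are
    free. *)
Definition primitive u g (a : C) :=
  (forall x, 0 < x -> cintegrable `]0, x[ g) /\
  (forall x, 0 < x -> u x = a + cint `]0, x[ g).

Lemma eq_primitive u v g h a : (forall x, 0 < x -> u x = v x) ->
  (forall x, 0 < x -> g x = h x) -> primitive u g a -> primitive v h a.
Proof.
move=> uv gh [ig ug].
have ghx x y : `]0, x[%classic y -> g y = h y.
  by rewrite /= in_itv/= => /andP[y0 _]; exact: gh.
split=> x x0.
  by apply: eq_cintegrable (ig _ x0); [exact: measurable_itv|exact: ghx].
by rewrite -uv// ug//; congr (_ + _); apply: eq_cint; exact: ghx.
Qed.

Lemma primitiveD u v g h a b : primitive u g a -> primitive v h b ->
  primitive (fun x => u x + v x) (fun x => g x + h x) (a + b).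
Proof.
move=> [ig ug] [ih vh]; split=> x x0.
  by apply: cintegrableD => //; [exact: ig|exact: ih].
rewrite ug// vh// cintD//; first by ring.
  exact: ig.
exact: ih.
Qed.

Lemma primitiveZ (c : C) u g a : primitive u g a ->
  primitive (fun x => c * u x) (fun x => c * g x) (c * a).
Proof.
move=> [ig ug]; split=> x x0; first by apply: cintegrableZ => //; exact: ig.
by rewrite ug// cintZ//; [ring|exact: ig].
Qed.

Lemma primitive_conj u g a : primitive u g a ->
  primitive (fun x => conjc (u x)) (fun x => conjc (g x)) (conjc a).
Proof.
have ReJ (z : C) : Re (conjc z) = Re z by case: z.
have ImJ (z : C) : Im (conjc z) = - Im z by case: z.
move=> [ig ug]; split=> x x0; have [i1 i2] := ig _ x0.
  split; first by apply: eq_integrable i1 => // y _; rewrite ReJ.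
  have := integrable_lin (- 1) 0 (measurable_itv _) i2 i2.
  by apply: eq_integrable => // y _ /=; rewrite mul0r addr0 ImJ mulN1r.
rewrite ug//; apply: complex_eq; rewrite ?(ReJ, ImJ, cReImE)//=.
  by congr (_ + _); apply: eq_Rintegral => y _; rewrite ReJ.
rewrite opprD; congr (_ + _).
transitivity (Rintegral leb `]0, x[ (fun y => (- 1) * Im (g y) + 0 * Im (g y))).
  by rewrite Rintegral_lin//; ring.
by apply: eq_Rintegral => y _; rewrite ImJ; ring.
Qed.

Lemma cprimitive_mul f g X :
  cintegrable `]0, X[ f -> cintegrable `]0, X[ g ->
  [/\ cintegrable `]0, X[ (fun s => f s * cint `]0, s[ g),
      cintegrable `]0, X[ (fun s => cint `]0, s[ f * g s) &
      cint `]0, X[ f * cint `]0, X[ g =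
      cint `]0, X[ (fun s => f s * cint `]0, s[ g) +
      cint `]0, X[ (fun s => cint `]0, s[ f * g s)].
Proof.
move=> [f1 f2] [g1 g2].
have mX : measurable (`]0%R, X[%classic : set (measurableTypeR R)) by [].
have [a1 b1 e1] := Rprimitive_mul f1 g1.
have [a2 b2 e2] := Rprimitive_mul f2 g2.
have [a3 b3 e3] := Rprimitive_mul f1 g2.
have [a4 b4 e4] := Rprimitive_mul f2 g1.
split.
- split.
    have := integrable_lin 1 (- 1) mX a1 a2.
    by apply: eq_integrable => // s _ /=; rewrite cReM /=; congr EFin; ring.
  have := integrable_lin 1 1 mX a3 a4.
  by apply: eq_integrable => // s _ /=; rewrite cImM /=; congr EFin; ring.
- split.
    have := integrable_lin 1 (- 1) mX b1 b2.
    by apply: eq_integrable => // s _ /=; rewrite cReM /=; congr EFin; ring.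
  have := integrable_lin 1 1 mX b3 b4.
  by apply: eq_integrable => // s _ /=; rewrite cImM /=; congr EFin; ring.
- apply: complex_eq; rewrite !cReImE /=.
    rewrite e1 e2.
    have -> : Rintegral leb `]0, X[ (fun x => Re (f x * cint `]0, x[ g)) =
      1 * Rintegral leb `]0, X[ (fun s => Re (f s) * Rintegral leb `]0, s[ (fun y => Re (g y))) +
      (- 1) * Rintegral leb `]0, X[ (fun s => Im (f s) * Rintegral leb `]0, s[ (fun y => Im (g y))).
      by rewrite -Rintegral_lin//; apply: eq_Rintegral => s _; rewrite cReM /=; ring.
    have -> : Rintegral leb `]0, X[ (fun x => Re (cint `]0, x[ f * g x)) =
      1 * Rintegral leb `]0, X[ (fun s => Rintegral leb `]0, s[ (fun y => Re (f y)) * Re (g s)) +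
      (- 1) * Rintegral leb `]0, X[ (fun s => Rintegral leb `]0, s[ (fun y => Im (f y)) * Im (g s)).
      by rewrite -Rintegral_lin//; apply: eq_Rintegral => s _; rewrite cReM /=; ring.
    by ring.
  rewrite e3 e4.
  have -> : Rintegral leb `]0, X[ (fun x => Im (f x * cint `]0, x[ g)) =
    1 * Rintegral leb `]0, X[ (fun s => Re (f s) * Rintegral leb `]0, s[ (fun y => Im (g y))) +
    1 * Rintegral leb `]0, X[ (fun s => Im (f s) * Rintegral leb `]0, s[ (fun y => Re (g y))).
    by rewrite -Rintegral_lin//; apply: eq_Rintegral => s _; rewrite cImM /=; ring.
  have -> : Rintegral leb `]0, X[ (fun x => Im (cint `]0, x[ f * g x)) =
    1 * Rintegral leb `]0, X[ (fun s => Rintegral leb `]0, s[ (fun y => Re (f y)) * Im (g s)) +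
    1 * Rintegral leb `]0, X[ (fun s => Rintegral leb `]0, s[ (fun y => Im (f y)) * Re (g s)).
    by rewrite -Rintegral_lin//; apply: eq_Rintegral => s _; rewrite cImM /=; ring.
  by ring.
Qed.

Lemma primitiveM u v g h a b : primitive u g a -> primitive v h b ->
  primitive (fun x => u x * v x) (fun x => g x * v x + u x * h x) (a * b).
Proof.
move=> [ig ug] [ih vh].
have gvuh X : 0 < X -> cintegrable `]0, X[ (fun x => g x * v x + u x * h x) /\
    a * b + cint `]0, X[ (fun x => g x * v x + u x * h x) = u X * v X.
  move=> X0; have [i1 i2 e] := cprimitive_mul (ig _ X0) (ih _ X0).
  have mX : measurable (`]0%R, X[%classic : set (measurableTypeR R)) by [].
  have ibg := cintegrableZ b mX (ig _ X0).
  have iah := cintegrableZ a mX (ih _ X0).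
  (* Writing [u = a + int g] and [v = b + int h] splits the derivative of [u v] into two constant
     multiples, integrated directly, and the two terms of integration by parts. *)
  have E x : `]0, X[%classic x -> g x * v x + u x * h x =
    (b * g x + a * h x) + (g x * cint `]0, x[ h + cint `]0, x[ g * h x).
    by rewrite /= in_itv/= => /andP[x0 _]; rewrite ug// vh//; ring.
  split.
    apply: (eq_cintegrable mX (fun x Xx => esym (E x Xx))).
    by apply: cintegrableD => //; exact: cintegrableD.
  rewrite (eq_cint E) !cintD//; [|exact: cintegrableD|exact: cintegrableD].
  by rewrite !cintZ//; [rewrite -e ug// vh//; ring|exact: ih|exact: ig].
by split=> x /gvuh[].
Qed.

End HalfLine.

(** * Energy estimates on the half-line *)

Section SquareIntegrable.
Context {R : realType}.

Lemma abs_dot_le (a b c d : R) :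
  `|a * c + b * d| <= a ^+ 2 + b ^+ 2 + (c ^+ 2 + d ^+ 2).
Proof.
rewrite ler_norml; apply/andP; split; rewrite -subr_ge0.
  have -> : a * c + b * d - - (a ^+ 2 + b ^+ 2 + (c ^+ 2 + d ^+ 2)) =
    2^-1 * ((a + c) ^+ 2 + (b + d) ^+ 2 + a ^+ 2 + b ^+ 2 + c ^+ 2 + d ^+ 2) by field.
  by rewrite mulr_ge0 ?invr_ge0 ?addr_ge0 ?sqr_ge0.
have -> : a ^+ 2 + b ^+ 2 + (c ^+ 2 + d ^+ 2) - (a * c + b * d) =
  2^-1 * ((a - c) ^+ 2 + (b - d) ^+ 2 + a ^+ 2 + b ^+ 2 + c ^+ 2 + d ^+ 2) by field.
by rewrite mulr_ge0 ?invr_ge0 ?addr_ge0 ?sqr_ge0.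
Qed.

Local Notation C := R[i].
Local Notation leb := (@lebesgue_measure R).
Local Notation half := (`]0, +oo[%classic : set (measurableTypeR R)).
Implicit Types (A B : set (measurableTypeR R)) (f g : R -> C).

(** Measurability is required on the whole line and only integrability on [A], which makes
    reflection and gluing painless. For [A = setT] this is [L2fun] by conversion. *)
Definition L2on A f :=
  measurable_fun setT (fun x => Re (f x)) /\
  measurable_fun setT (fun x => Im (f x)) /\
  leb.-integrable A (fun x => (csq (f x))%:E).

Definition L2sqon A f : R := Rintegral leb A (fun x => csq (f x)).

Lemma L2on_cmeas A f : L2on A f -> cmeas f. Proof. by case=> ? []. Qed.

Lemma L2onI A f : cmeas f -> leb.-integrable A (fun x => (csq (f x))%:E) -> L2on A f.
Proof. by case. Qed.

Lemma L2sqon_ge0 A f : 0 <= L2sqon A f.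
Proof. by apply: Rintegral_ge0 => x _; exact: csq_ge0. Qed.

Lemma L2onS A B f : measurable A -> measurable B -> B `<=` A ->
  L2on A f -> L2on B f.
Proof.
by move=> mA mB BA [f1 [f2 i]]; split=> //; split=> //; apply: integrableS i.
Qed.

Lemma L2sqonS A B f : measurable A -> measurable B -> B `<=` A ->
  L2on A f -> L2sqon B f <= L2sqon A f.
Proof.
move=> mA mB BA Lf; have [f1 [f2 i]] := Lf.
have [_ [_ j]] := L2onS mA mB BA Lf.
rewrite /L2sqon /Rintegral fine_le ?integrable_fin_num//.
apply: ge0_subset_integral => //.
- by apply: measurable_funTS; apply/measurable_EFinP; exact: measurable_csq.
- by move=> x _; rewrite lee_fin csq_ge0.
Qed.

Lemma L2onZ A f (c : C) : measurable A -> L2on A f -> L2on A (fun x => c * f x).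
Proof.
move=> mA Lf; apply: L2onI.
  by apply: cmeasM; [exact: cmeas_cst|exact: L2on_cmeas Lf].
have [_ [_ i]] := Lf.
have := integrable_lin (csq c) 0 mA i i; apply: eq_integrable => // x _ /=.
by rewrite csqM mul0r addr0.
Qed.

Lemma L2sqonZ A f (c : C) : measurable A -> L2on A f ->
  L2sqon A (fun x => c * f x) = csq c * L2sqon A f.
Proof.
move=> mA [_ [_ i]]; rewrite /L2sqon -RintegralZl//.
by apply: eq_Rintegral => x _; rewrite csqM.
Qed.

Lemma L2onD A f g : measurable A -> L2on A f -> L2on A g ->
  L2on A (fun x => f x + g x).
Proof.
move=> mA Lf Lg; have mfg := cmeasD (L2on_cmeas Lf) (L2on_cmeas Lg).
apply: L2onI => //; have [_ [_ i]] := Lf; have [_ [_ j]] := Lg.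
have := integrable_lin 2 2 mA i j; apply: le_integrableR => //.
  exact: measurable_csq.
by move=> x _ /=; rewrite ger0_norm ?csq_ge0// csqD_le.
Qed.

Lemma L2sqonD_le A f g : measurable A -> L2on A f -> L2on A g ->
  L2sqon A (fun x => f x + g x) <= 2 * L2sqon A f + 2 * L2sqon A g.
Proof.
move=> mA Lf Lg; have [_ [_ k]] := L2onD mA Lf Lg.
have [_ [_ i]] := Lf; have [_ [_ j]] := Lg.
rewrite /L2sqon -Rintegral_lin//; apply: le_Rintegral => //.
  exact: integrable_lin.
by move=> x _; exact: csqD_le.
Qed.

Lemma L2onM A f g : measurable A -> L2on A f -> L2on A g ->
  cintegrable A (fun x => f x * g x).
Proof.
move=> mA Lf Lg.
have [m1 m2] := cmeasM (L2on_cmeas Lf) (L2on_cmeas Lg).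
have [_ [_ i]] := Lf; have [_ [_ j]] := Lg.
have ij := integrable_lin 1 1 mA i j.
split.
  apply: le_integrableR ij => // x _; rewrite !mul1r /csq cReM -mulNr.
  by rewrite -(sqrrN (Im (f x))) abs_dot_le.
apply: le_integrableR ij => // x _; rewrite !mul1r /csq cImM.
by rewrite [X in _ + _ + X]addrC abs_dot_le.
Qed.

Lemma L2on_cst (a b : R) (c : C) : L2on `]a, b[ (fun=> c).
Proof.
apply: L2onI; first exact: cmeas_cst.
exact: (integrable_cst_itv a b (csq c)).
Qed.

Lemma subset_half (X : R) : `]0, X[ `<=` half.
Proof. by move=> x /=; rewrite !in_itv/= andbT => /andP[]. Qed.

Lemma L2on_half_itv f (X : R) : L2on half f -> L2on `]0, X[ f.
Proof. by apply: L2onS => //; exact: subset_half. Qed.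

Lemma L2on_cintegrable f (X : R) : L2on half f -> cintegrable `]0, X[ f.
Proof.
move=> Lf.
have := L2onM (measurable_itv _) (L2on_half_itv X Lf) (L2on_cst 0 X 1).
by apply: eq_cintegrable => // x _; rewrite mulr1.
Qed.

End SquareIntegrable.

Section Energy.
Context {R : realType}.
Local Notation C := R[i].
Local Notation leb := (@lebesgue_measure R).
Local Notation half := (`]0, +oo[%classic : set (measurableTypeR R)).
Implicit Types (p P : R -> C) (l : C) (X k : R).

(** Twice the real part of [x] times the conjugate of [y], that is the derivative of [|p|^2] when
    [x = p] and [y = p']. *)
Definition Redot (x y : C) : R := 2 * (Re x * Re y + Im x * Im y).

Lemma primitive_csq p g (p0 : C) : primitive p g p0 -> forall X, 0 < X ->
  leb.-integrable `]0, X[ (EFin \o (fun x => Redot (p x) (g x))) /\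
  csq (p X) = csq p0 + Rintegral leb `]0, X[ (fun x => Redot (p x) (g x)).
Proof.
move=> pg X X0; have [ig pX] := primitiveM pg (primitive_conj pg).
have [i1 _] := ig _ X0.
have E x : Re (g x * conjc (p x) + p x * conjc (g x)) = Redot (p x) (g x).
  by rewrite /Redot; case: (g x) => a b; case: (p x) => c d /=; ring.
have Ec (z : C) : Re (z * conjc z) = csq z.
  by rewrite /csq; case: z => a b /=; ring.
split; first by apply: eq_integrable i1 => // x _; rewrite E.
rewrite -!Ec pX// cReD /=; congr (_ + _).
by apply: eq_Rintegral => x _; rewrite E.
Qed.

(** On a bounded interval a primitive is bounded: the identity for [|p|^2] gives the constant [M],
    with the absolute value taken inside the integral. *)
Lemma primitive_L2on p g (p0 : C) : primitive p g p0 -> cmeas p ->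
  forall X, 0 < X -> L2on `]0, X[ p.
Proof.
move=> pg mp X X0; apply: L2onI => //.
have [iX _] := primitive_csq pg X0.
have mX : measurable (`]0%R, X[%classic : set (measurableTypeR R)) by [].
pose M := csq p0 + Rintegral leb `]0, X[ (fun x => `|Redot (p x) (g x)|).
apply: (le_integrableR mX (measurable_csq mp) _ (integrable_cst_itv 0 X M)).
move=> y; rewrite /= in_itv/= => /andP[y0 yX].
have [iy ->] := primitive_csq pg y0.
rewrite (le_trans (ler_normD _ _))// ger0_norm ?csq_ge0// lerD2l.
have my : measurable (`]0%R, y[%classic : set (measurableTypeR R)) by [].
rewrite (le_trans (le_normr_Rintegral my iy))//.
have inX := integrable_norm iX; have iny := integrable_norm iy.
rewrite /Rintegral fine_le ?integrable_fin_num//.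
apply: ge0_subset_integral => //.
- exact: measurable_int inX.
- by apply: subset_itvl; rewrite bnd_simp ltW.
Qed.

Lemma Redot_le k (x y : C) : 0 < k -> `|Redot x y| <= k * csq x + k^-1 * csq y.
Proof.
move=> k0; rewrite /Redot /csq.
(* Completing the square with a sign [s = 1] or [s = -1] gives both halves of the absolute value
   bound at once. *)
have E (s : R) : s ^+ 2 = 1 -> k * (Re x ^+ 2 + Im x ^+ 2) + k^-1 * (Re y ^+ 2 + Im y ^+ 2)
   - s * (2 * (Re x * Re y + Im x * Im y)) =
   k^-1 * ((k * Re x - s * Re y) ^+ 2 + (k * Im x - s * Im y) ^+ 2).
  by move=> s2; rewrite !sqrrB !exprMn s2; field; rewrite gt_eqF.
have N (s : R) : s ^+ 2 = 1 -> s * (2 * (Re x * Re y + Im x * Im y)) <=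
   k * (Re x ^+ 2 + Im x ^+ 2) + k^-1 * (Re y ^+ 2 + Im y ^+ 2).
  move=> s2; rewrite -subr_ge0 E// mulr_ge0 ?invr_ge0 ?(ltW k0)//.
  by rewrite addr_ge0 ?sqr_ge0.
rewrite ler_norml; apply/andP; split.
  by rewrite lerNl -mulN1r N// sqrrN expr1n.
by rewrite -[leLHS]mul1r N// expr1n.
Qed.

(** Integrate [(|p|^2)' = 2 Re l |p|^2 + 2 Re (p conj P)] and apply Young's inequality with weight
    [k]. The norm of [p] stays local to []0, X[], so that square integrability on the half-line can
    be deduced rather than assumed. With [|Re l| = k], half of the main term absorbs the Young
    term. *)
Lemma energy l p P (p0 : C) k X : 0 < k -> 0 < X ->
  primitive p (fun x => l * p x + P x) p0 -> cmeas p -> L2on half P ->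
  `|csq (p X) - csq p0 - 2 * Re l * L2sqon `]0, X[ p| <=
  k * L2sqon `]0, X[ p + k^-1 * L2sqon half P.
Proof.
move=> k0 X0 pP mp LP.
have mX : measurable (`]0%R, X[%classic : set (measurableTypeR R)) by [].
have [iE eE] := primitive_csq pP X0.
have [_ [_ ip]] := primitive_L2on pP mp X0.
have [_ [_ iP]] := L2on_half_itv X LP.
have E x : Redot (p x) (l * p x + P x) = 2 * Re l * csq (p x) + 1 * Redot (p x) (P x).
  by rewrite /Redot /csq !cReImE; ring.
have iD : leb.-integrable `]0, X[ (EFin \o (fun x => Redot (p x) (P x))).
  have := integrable_lin 1 (- (2 * Re l)) mX iE ip.
  by apply: eq_integrable => // x _ /=; rewrite E; congr EFin; ring.
have -> : csq (p X) - csq p0 - 2 * Re l * L2sqon `]0, X[ p =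
    Rintegral leb `]0, X[ (fun x => Redot (p x) (P x)).
  rewrite eE (_ : Rintegral leb _ _ =
    2 * Re l * L2sqon `]0, X[ p + 1 * Rintegral leb `]0, X[ (fun x => Redot (p x) (P x))).
    by ring.
  by rewrite -Rintegral_lin//; apply: eq_Rintegral => x _; rewrite E.
rewrite (le_trans (le_normr_Rintegral mX iD))//.
apply: (@le_trans _ _ (k * L2sqon `]0, X[ p + k^-1 * L2sqon `]0, X[ P)).
  rewrite /L2sqon -Rintegral_lin//; apply: le_Rintegral => //.
  - exact: integrable_norm.
  - exact: integrable_lin.
  - by move=> x _; exact: Redot_le.
rewrite lerD2l ler_wpM2l ?invr_ge0 ?(ltW k0)//.
by apply: L2sqonS => //; exact: subset_half.
Qed.

(** For [Re l = - k] the energy inequality bounds [k] times the local norm uniformly in [X] once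
    [|p(X)|^2 >= 0] is dropped. Every solution is therefore square integrable, whatever its
    trace. *)
Lemma decay_bound l p P (p0 : C) k : 0 < k -> Re l = - k ->
  primitive p (fun x => l * p x + P x) p0 -> cmeas p -> L2on half P ->
  L2on half p /\ k * L2sqon half p <= csq p0 + k^-1 * L2sqon half P.
Proof.
move=> k0 lk pP mp LP.
set B := csq p0 + k^-1 * L2sqon half P.
have [] := @integrable_ge0_half R (fun x => csq (p x)) (k^-1 * B) (measurable_csq mp)
    (fun x => csq_ge0 (p x)).
  move=> Y; exists (Num.max Y 0 + 1).
    by rewrite (@le_lt_trans _ _ (Num.max Y 0))// ?le_max ?lexx// ltrDl.
  set X := Num.max Y 0 + 1; have X0 : 0 < X.
    by rewrite /X ltr_wpDl// le_max lexx orbT.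
  have [_ [_ ip]] := primitive_L2on pP mp X0; split=> //.
  rewrite ler_pdivlMl//.
  have := energy k0 X0 pP mp LP; rewrite lk ler_norml => /andP[_].
  have := csq_ge0 (p X); rewrite -/(L2sqon _ p) /B; lra.
move=> ih bh; split; first exact: L2onI.
by rewrite -ler_pdivlMl.
Qed.

(** For [Re l = k] the local norm is controlled by [|p(X)|^2], so a solution that stays bounded is
    square integrable. *)
Lemma growth_L2on l p P (p0 : C) k M : 0 < k -> Re l = k ->
  primitive p (fun x => l * p x + P x) p0 -> cmeas p -> L2on half P ->
  (forall X, 0 < X -> csq (p X) <= M) -> L2on half p.
Proof.
move=> k0 lk pP mp LP pM.
set B := M + k^-1 * L2sqon half P.
have [] := @integrable_ge0_half R (fun x => csq (p x)) (k^-1 * B) (measurable_csq mp)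
    (fun x => csq_ge0 (p x)).
  move=> Y; exists (Num.max Y 0 + 1).
    by rewrite (@le_lt_trans _ _ (Num.max Y 0))// ?le_max ?lexx// ltrDl.
  set X := Num.max Y 0 + 1; have X0 : 0 < X.
    by rewrite /X ltr_wpDl// le_max lexx orbT.
  have [_ [_ ip]] := primitive_L2on pP mp X0; split=> //.
  rewrite ler_pdivlMl//.
  have := energy k0 X0 pP mp LP; rewrite lk ler_norml => /andP[+ _].
  have := csq_ge0 p0; have := pM _ X0; rewrite -/(L2sqon _ p) /B; lra.
by move=> ih bh; exact: L2onI.
Qed.

(** If [|p|^2] exceeded [e] beyond [max Y 0], an interval of length [N] there would contribute at
    least the whole squared norm plus one. *)
Lemma L2on_half_small p (e Y : R) : L2on half p -> 0 < e ->
  exists X, [/\ Y < X, 0 < X & csq (p X) <= e].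
Proof.
move=> Lp e0; apply: contrapT => H.
have pe X : Y < X -> 0 < X -> e <= csq (p X).
  by move=> YX X0; rewrite leNgt; apply/negP => /ltW pX; apply: H; exists X.
pose M := Num.max Y 0.
have M0 : 0 <= M by rewrite le_max lexx orbT.
pose N := (L2sqon half p + 1) / e.
have N0 : 0 < N by rewrite divr_gt0// ltr_wpDl// L2sqon_ge0.
have sub : `]M, (M + N)[ `<=` half.
  move=> x; rewrite /= !in_itv/= andbT => /andP[Mx _]; exact: le_lt_trans Mx.
have mMN : measurable (`]M, (M + N)[%classic : set (measurableTypeR R)) by [].
have mh : measurable half by exact: measurable_itv.
have := L2sqonS mh mMN sub Lp; apply/negP; rewrite -ltNge.
have [_ [_ ip]] := L2onS mh mMN sub Lp.
have : Rintegral leb `]M, (M + N)[ (cst e) <= L2sqon `]M, (M + N)[ p.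
  apply: le_Rintegral => //; first exact: (integrable_cst_itv M (M + N) e).
  move=> x; rewrite /= in_itv/= => /andP[Mx _]; apply: pe.
    by apply: le_lt_trans Mx; rewrite le_max lexx.
  exact: le_lt_trans Mx.
apply: lt_le_trans.
rewrite Rintegral_cst//= lebesgue_measure_itv/= lte_fin ltrDl N0.
rewrite -EFinB/= addrAC subrr add0r /N mulrC divfK ?gt_eqF//.
by rewrite ltrDl.
Qed.

(** Apply the energy inequality at points where [|p(X)|^2] is at most an arbitrary [e], which square
    integrability provides. Here the trace is on the bounded side: in the growing direction the data
    control it. *)
Lemma growth_bound l p P (p0 : C) k : 0 < k -> Re l = k ->
  primitive p (fun x => l * p x + P x) p0 -> L2on half p -> L2on half P ->
  csq p0 + k * L2sqon half p <= k^-1 * L2sqon half P.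
Proof.
move=> k0 lk pP Lp LP; have mp := L2on_cmeas Lp.
apply/ler_addgt0Pr => e e0.
set B := k^-1 * L2sqon half P + e - csq p0.
have [] := @integrable_ge0_half R (fun x => csq (p x)) (k^-1 * B) (measurable_csq mp)
    (fun x => csq_ge0 (p x)).
  move=> Y; have [X [YX X0 pX]] := L2on_half_small Y Lp e0.
  exists X => //.
  have [_ [_ ip]] := primitive_L2on pP mp X0; split=> //.
  rewrite ler_pdivlMl//.
  have := energy k0 X0 pP mp LP; rewrite lk ler_norml => /andP[+ _].
  rewrite -/(L2sqon _ p) /B; lra.
move=> _; rewrite -/(L2sqon _ p) ler_pdivlMl// /B; lra.
Qed.

End Energy.

(** * Solutions on the half-line *)

Section ComplexExponential.
Context {R : realType}.
Local Notation C := R[i].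
Local Notation leb := (@lebesgue_measure R).
Local Notation half := (`]0, +oo[%classic : set (measurableTypeR R)).
Implicit Types (a : C) (x X : R).

Lemma is_derive_continuous (F f : R -> R) : (forall x, is_derive x 1 F (f x)) ->
  continuous F.
Proof.
move=> dF x; apply: differentiable_continuous; apply/derivable1_diffP.
by case: (dF x).
Qed.

Lemma Rprimitive_C1 (F f : R -> R) X : (forall x, is_derive x 1 F (f x)) ->
  continuous f -> 0 < X ->
  leb.-integrable `]0, X[ (EFin \o f) /\ F X = F 0 + Rintegral leb `]0, X[ f.
Proof.
move=> dF cf X0.
have cF := is_derive_continuous dF.
have mf : measurable_fun (`]0%R, X[%classic : set (measurableTypeR R)) (EFin \o f).
  by apply: measurable_funTS; apply/measurable_EFinP; exact: continuous_measurable_fun.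
have cfX : {within `[0, X], continuous f} by exact: continuous_subspaceT.
have ic : leb.-integrable `[0, X] (EFin \o f).
  by apply: continuous_compact_integrable => //; exact: segment_compact.
have io : leb.-integrable `]0, X[ (EFin \o f).
  apply: integrableS ic => //; exact: subset_itv_oo_cc.
split=> //.
have E : (\int[leb]_(x in `]0%R, X[) (f x)%:E = (F X)%:E - (F 0)%:E)%E.
  transitivity (\int[leb]_(x in `[0%R, X]) (f x)%:E)%E.
    by symmetry; apply: (@integral_itv_bndoo R 0 X (EFin \o f) true false).
  apply: continuous_FTC2 => //.
    split.
    - by move=> x _; case: (dF x).
    - by apply: cvg_at_right_filter; exact: cF.
    - by apply: cvg_at_left_filter; exact: cF.
  by move=> x _; rewrite derive1E; case: (dF x).
by rewrite /Rintegral E -EFinB /=; ring.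
Qed.

(** The exponential [e^(a x)] of a real variable [x], spelled out in real functions. *)
Definition cexp a x : C :=
  Complex (expR (Re a * x) * cos (Im a * x)) (expR (Re a * x) * sin (Im a * x)).

Lemma cexpNK a x : cexp a x * cexp (- a) x = 1.
Proof.
have e1 : expR (Re a * x) * expR (- (Re a * x)) = 1 by rewrite -expRD subrr expR0.
apply: complex_eq; rewrite ?cReM ?cImM /cexp /= !(cReN, cImN) !mulNr cosN sinN.
  rewrite -[RHS]e1 -[RHS]mulr1 -(cos2Dsin2 (Im a * x)); ring.
ring.
Qed.

Lemma is_derive_scale (c x : R) : is_derive x 1 (fun y : R => c * y) c.
Proof.
have := is_deriveZ c (is_derive_id x 1); rewrite /= [X in is_derive _ _ _ X](_ : _ = c)//.
by rewrite /GRing.scale /= mulr1.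
Qed.

Lemma is_derive_expcos (r w x : R) :
  is_derive x 1 (fun y => expR (r * y) * cos (w * y))
    (r * (expR (r * x) * cos (w * x)) - w * (expR (r * x) * sin (w * x))).
Proof.
have dE := is_derive1_comp (is_derive_expR (r * x)) (is_derive_scale r x).
have dC := is_derive1_comp (is_derive_cos (w * x)) (is_derive_scale w x).
apply: (is_derive_eq (is_deriveM dE dC)).
by rewrite /GRing.scale /=; ring.
Qed.

Lemma is_derive_expsin (r w x : R) :
  is_derive x 1 (fun y => expR (r * y) * sin (w * y))
    (r * (expR (r * x) * sin (w * x)) + w * (expR (r * x) * cos (w * x))).
Proof.
have dE := is_derive1_comp (is_derive_expR (r * x)) (is_derive_scale r x).
have dC := is_derive1_comp (is_derive_sin (w * x)) (is_derive_scale w x).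
apply: (is_derive_eq (is_deriveM dE dC)).
by rewrite /GRing.scale /=; ring.
Qed.

Lemma cmeas_cexp a : cmeas (cexp a).
Proof.
split; apply: continuous_measurable_fun.
  exact: is_derive_continuous (is_derive_expcos (Re a) (Im a)).
exact: is_derive_continuous (is_derive_expsin (Re a) (Im a)).
Qed.

Lemma primitive_cexp a : primitive (cexp a) (fun x => a * cexp a x) 1.
Proof.
have c1 := is_derive_continuous (is_derive_expcos (Re a) (Im a)).
have c2 := is_derive_continuous (is_derive_expsin (Re a) (Im a)).
have H X : 0 < X -> cintegrable `]0, X[ (fun x => a * cexp a x) /\
    cexp a X = 1 + cint `]0, X[ (fun x => a * cexp a x).
  move=> X0.
  have [|i1 e1] := Rprimitive_C1 (is_derive_expcos (Re a) (Im a)) _ X0.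
    by move=> x; apply: cvgB; apply: cvgM => //;
      [exact: cvg_cst|exact: c1|exact: cvg_cst|exact: c2].
  have [|i2 e2] := Rprimitive_C1 (is_derive_expsin (Re a) (Im a)) _ X0.
    by move=> x; apply: cvgD; apply: cvgM => //;
      [exact: cvg_cst|exact: c2|exact: cvg_cst|exact: c1].
  split.
    split.
      by apply: eq_integrable i1 => // x _; rewrite cReM.
    by apply: eq_integrable i2 => // x _; rewrite cImM /= addrC.
  apply: complex_eq; rewrite ?(cReD, cImD) /=.
    rewrite e1 !mulr0 expR0 cos0 mulr1; congr (_ + _).
    by apply: eq_Rintegral => x _; rewrite cReM.
  rewrite e2 !mulr0 sin0 mulr0; congr (_ + _).
  by apply: eq_Rintegral => x _; rewrite cImM /= addrC.
by split=> x /H[].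
Qed.

(** Tonelli's measurability of partial integrals, applied to the positive and negative parts on the
    region [0 < y < x]; this way no integrability of [g] is required. *)
Lemma cmeas_cprimitive (g : R -> C) : cmeas g -> cmeas (fun x => cint `]0, x[ g).
Proof.
have H (F : R -> R) : measurable_fun setT F ->
    measurable_fun setT (fun x : R => Rintegral leb `]0, x[ F).
  move=> mF.
  have K (G : R -> \bar R) : measurable_fun setT G -> (forall y, (0 <= G y)%E) ->
      measurable_fun setT (fun x : R => \int[leb]_(y in `]0%R, x[) G y)%E.
    move=> mG G0.
    pose k (p : R * R) := if (0 < p.2) && (p.2 < p.1) then G p.2 else 0%E.
    have mk : measurable_fun setT k.
      apply: measurable_fun_ifT => //.
      - by apply: measurable_and; exact: measurable_fun_ltr.
      - exact: measurableT_comp.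
    have k0 p : (0 <= k p)%E by rewrite /k; case: ifP.
    have := @measurable_fun_fubini_tonelli_F _ _ _ _ R leb k mk k0.
    congr (measurable_fun _ _); apply/funext => x.
    rewrite /fubini_F [RHS]integral_mkcond; apply: eq_integral => y _.
    rewrite patchE /k /=; case: ifPn => yx.
      by rewrite mem_set//= in_itv.
    by rewrite memNset//= in_itv/=; exact/negP.
  have mEF : measurable_fun setT (EFin \o F) by exact/measurable_EFinP.
  apply: measurableT_comp; first exact: fine_measurable.
  under eq_fun do rewrite integralE.
  apply: emeasurable_funB; apply: K.
  - exact: measurable_funepos.
  - by move=> y; exact: funepos_ge0.
  - exact: measurable_funeneg.
  - by move=> y; exact: funeneg_ge0.
by move=> [g1 g2]; split; exact: H.
Qed.

End ComplexExponential.

Section HalfLineSolutions.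
Context {R : realType}.
Local Notation C := R[i].
Local Notation leb := (@lebesgue_measure R).
Local Notation half := (`]0, +oo[%classic : set (measurableTypeR R)).
Implicit Types (a l : C) (P Q : R -> C) (X k : R).

(** Variation of constants for [q' = a q + Q] with trace [q0]. *)
Definition duhamel a Q (q0 : C) (x : R) : C :=
  cexp a x * (q0 + cint `]0, x[ (fun y => cexp (- a) y * Q y)).

Lemma cmeas_duhamel a Q q0 : cmeas Q -> cmeas (duhamel a Q q0).
Proof.
move=> mQ; apply: cmeasM; first exact: cmeas_cexp.
apply: cmeasD; first exact: cmeas_cst.
by apply: cmeas_cprimitive; apply: cmeasM => //; exact: cmeas_cexp.
Qed.

Lemma primitive_duhamel a Q q0 : L2on half Q ->
  primitive (duhamel a Q q0) (fun x => a * duhamel a Q q0 x + Q x) q0.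
Proof.
move=> LQ.
have W : primitive (fun x => q0 + cint `]0, x[ (fun y => cexp (- a) y * Q y))
    (fun y => cexp (- a) y * Q y) q0.
  split=> // x x0; apply: L2onM => //.
    exact: (primitive_L2on (primitive_cexp (- a)) (cmeas_cexp _) x0).
  exact: L2on_half_itv.
have := primitiveM (primitive_cexp a) W; rewrite mul1r.
apply: eq_primitive => // x x0; rewrite /duhamel.
by rewrite (mulrA (cexp a x)) cexpNK mul1r (mulrA a).
Qed.

Lemma decay_exists l P (p0 : C) k : 0 < k -> Re l = - k -> L2on half P ->
  exists p, L2on half p /\ primitive p (fun x => l * p x + P x) p0.
Proof.
move=> k0 lk LP; exists (duhamel l P p0).
have pP := primitive_duhamel l p0 LP; split=> //.
have mp := cmeas_duhamel l p0 (L2on_cmeas LP).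
by have [] := decay_bound k0 lk pP mp LP.
Qed.

(** The energy identity is exact here: [2 k] times the integral over []0, Y[] is [1 - |e^(a Y)|^2].
    Subtracting the part before [X] leaves a tail proportional to [|e^(a X)|^2], just what cancels
    the growth in [growth_exists]. *)
Lemma cexp_tail_bound a k X : 0 < k -> Re a = - k -> 0 < X ->
  leb.-integrable `[X, +oo[ (EFin \o (fun y => csq (cexp a y))) /\
  L2sqon `[X, +oo[ (cexp a) <= (2 * k)^-1 * csq (cexp a X).
Proof.
move=> k0 ak X0.
have pE := primitive_cexp a; have mE := cmeas_cexp a.
have Rd (z : C) : Redot z (a * z) = - (2 * k) * csq z + 0 * csq z.
  by rewrite /Redot /csq !cReImE ak; ring.
have eE Y : 0 < Y -> 2 * k * L2sqon `]0, Y[ (cexp a) = 1 - csq (cexp a Y).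
  move=> Y0; have [_ ->] := primitive_csq pE Y0.
  have [_ [_ iY]] := primitive_L2on pE mE Y0.
  rewrite (_ : Rintegral leb _ _ = - (2 * k) * L2sqon `]0, Y[ (cexp a) +
    0 * L2sqon `]0, Y[ (cexp a)).
    by rewrite csq1; ring.
  by rewrite -Rintegral_lin//; apply: eq_Rintegral => x _; rewrite Rd.
have k20 : 0 < 2 * k by rewrite mulr_gt0.
have [] := @integrable_ge0_half R (fun x => csq (cexp a x)) (2 * k)^-1 (measurable_csq mE)
    (fun x => csq_ge0 _).
  move=> Y; exists (Num.max Y 0 + 1).
    by rewrite (@le_lt_trans _ _ (Num.max Y 0))// ?le_max ?lexx// ltrDl.
  set Z := Num.max Y 0 + 1; have Z0 : 0 < Z.
    by rewrite /Z ltr_wpDl// le_max lexx orbT.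
  have [_ [_ ip]] := primitive_L2on pE mE Z0; split=> //.
  rewrite -[leRHS]mulr1 ler_pdivlMl//.
  by have := eE _ Z0; rewrite /L2sqon => ->; rewrite gerBl csq_ge0.
move=> ih bh.
have mX : measurable (`[X, +oo[%classic : set (measurableTypeR R)) by [].
have m0X : measurable (`]0%R, X[%classic : set (measurableTypeR R)) by [].
have U : half = `]0, X[ `|` `[X, +oo[.
  by rewrite -(@itv_bndbnd_setU _ _ (BRight 0) (BLeft X) (BInfty _ false)) ?bnd_simp.
have dj : [disjoint `]0%R, X[%classic & `[X, +oo[%classic].
  apply/disj_set2P; apply/seteqP; split=> // x [] /=; rewrite !in_itv/= andbT.
  by move=> /andP[_ xX]; rewrite leNgt xX.
have iU := ih; rewrite U in iU.
have sX : `[X, +oo[ `<=` half.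
  by move=> x /=; rewrite !in_itv/= !andbT; exact: lt_le_trans.
split; first by apply: integrableS ih => //; exact: measurable_itv.
have := bh; rewrite U Rintegral_setU// -/(L2sqon _ (cexp a)) -/(L2sqon `[X, +oo[ (cexp a)).
rewrite -[(2 * k)^-1 in X in X -> _]mulr1 !ler_pdivlMl// mulrDr (eE _ X0); lra.
Qed.

Lemma growth_exists l Q k : 0 < k -> Re l = k -> L2on half Q ->
  exists q q0, L2on half q /\ primitive q (fun x => l * q x + Q x) q0.
Proof.
move=> k0 lk LQ.
have lkN : Re (- l) = - k by rewrite cReN lk.
have mhalf : measurable half by exact: measurable_itv.
have LE : L2on half (cexp (- l)).
  have L0 : L2on half (fun=> 0 : C).
    have := L2onZ (0 : C) mhalf LQ; congr L2on; apply/funext => x; exact: mul0r.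
  have := @decay_bound _ (- l) (cexp (- l)) (fun=> 0) 1 k k0 lkN.
  case=> //; last exact: cmeas_cexp.
  by apply: eq_primitive (primitive_cexp (- l)) => // x _; rewrite addr0.
have iEQ := L2onM mhalf LE LQ.
pose q0 := - cint half (fun y => cexp (- l) y * Q y).
exists (duhamel l Q q0), q0.
have pq := primitive_duhamel l q0 LQ; split=> //.
have mq := cmeas_duhamel l q0 (L2on_cmeas LQ).
(* Bound a product by the sum of the two squared moduli. The exponential part contributes at most
   [(2 k)^-1], the rest at most the squared norm of [Q]; real and imaginary parts each obey the
   bound [m], whence [2 * m ^+ 2]. *)
pose m := (2 * k)^-1 + L2sqon half Q.
apply: (growth_L2on (M := 2 * m ^+ 2) k0 lk pq mq LQ) => X X0.
have mX : measurable (`[X, +oo[%classic : set (measurableTypeR R)) by [].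
have m0X : measurable (`]0%R, X[%classic : set (measurableTypeR R)) by [].
have U : half = `]0, X[ `|` `[X, +oo[.
  by rewrite -(@itv_bndbnd_setU _ _ (BRight 0) (BLeft X) (BInfty _ false)) ?bnd_simp.
have dj : [disjoint `]0%R, X[%classic & `[X, +oo[%classic].
  apply/disj_set2P; apply/seteqP; split=> // x [] /=; rewrite !in_itv/= andbT.
  by move=> /andP[_ xX]; rewrite leNgt xX.
have sX : `[X, +oo[ `<=` half.
  by move=> x /=; rewrite !in_itv/= !andbT; exact: lt_le_trans.
have iX := cintegrableS mhalf mX sX iEQ.
have -> : duhamel l Q q0 X =
    - cint `[X, +oo[ (fun y => cexp l X * (cexp (- l) y * Q y)).
  rewrite cintZ// /duhamel /q0; have iEQ' := iEQ; rewrite U in iEQ' *.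
  by rewrite cint_setU//; ring.
rewrite csqN.
have [iT leT] := cexp_tail_bound k0 lkN X0.
have [_ [_ iQ]] := L2onS mhalf mX sX LQ.
have ib := integrable_lin (csq (cexp l X)) 1 mX iT iQ.
have bm : Rintegral leb `[X, +oo[
    (fun y => csq (cexp l X) * csq (cexp (- l) y) + 1 * csq (Q y)) <= m.
  rewrite Rintegral_lin// mul1r; apply: lerD; last exact: L2sqonS.
  rewrite (le_trans (ler_wpM2l (csq_ge0 _) leT))// mulrCA -csqM cexpNK.
  by rewrite csq1 mulr1.
have iZ := cintegrableZ (cexp l X) mX iX.
have bd (h : R -> R) : measurable_fun setT h ->
    leb.-integrable `[X, +oo[ (EFin \o h) ->
    (forall y, `|h y| <= csq (cexp l X) * csq (cexp (- l) y) + 1 * csq (Q y)) ->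
    Rintegral leb `[X, +oo[ h ^+ 2 <= m ^+ 2.
  move=> mh ih hb; rewrite -(real_normK (num_real (Rintegral _ _ _))) lerXn2r// ?nnegrE//.
    by rewrite addr_ge0 ?L2sqon_ge0// invr_ge0 mulr_ge0// ltW.
  apply: le_trans bm; apply: le_trans (le_normr_Rintegral mX ih) _.
  by apply: le_Rintegral => //; exact: integrable_norm.
have [mZ1 mZ2] : cmeas (fun y => cexp l X * (cexp (- l) y * Q y)).
  apply: cmeasM; first exact: cmeas_cst.
  by apply: cmeasM; [exact: cmeas_cexp|exact: L2on_cmeas LQ].
have [iZ1 iZ2] := iZ.
rewrite {1}/csq /= mulr2n mulrDl !mul1r; apply: lerD; apply: bd => // y.
  rewrite mulrA -csqM mul1r /csq cReM -mulNr -(sqrrN (Im (_ * _))).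
  exact: abs_dot_le.
rewrite mulrA -csqM mul1r /csq cImM [X in _ + _ + X]addrC.
exact: abs_dot_le.
Qed.

End HalfLineSolutions.

(** * The transmission problem on the line *)

Section FullLine.
Context {R : realType}.
Local Notation C := R[i].
Local Notation leb := (@lebesgue_measure R).
Local Notation half := (`]0, +oo[%classic : set (measurableTypeR R)).
Implicit Types (f g u v psi : R -> C) (F : R -> \bar R).

Lemma ge0_integral_fold F : measurable_fun setT F -> (forall x, (0 <= F x)%E) ->
  (\int[leb]_x F x =
   \int[leb]_(x in half) F x + \int[leb]_(x in half) F (- (x : R))%R)%E.
Proof.
move=> mF F0.
have U : [set: R] = `]-oo, 0%R]%classic `|` `]0%R, +oo[%classic.
  by rewrite -itv_bndbnd_setU// set_itvNyy.
have dj : [disjoint (`]-oo, 0%R]%classic : set R) & `]0%R, +oo[%classic].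
  apply/disj_set2P; apply/seteqP; split=> // x [] /=; rewrite !in_itv/= andbT.
  by move=> x0; rewrite ltNge x0.
rewrite [in LHS]U ge0_integral_setU//=; last by apply: measurable_funTS.
rewrite addeC; congr (_ + _)%E.
transitivity (\int[leb]_(x in `]-oo, 0%R[) F x)%E.
  by symmetry; apply: integral_itv_bndo_bndc; exact: measurable_funTS.
rewrite -(ge0_integral_reflect (measurable_itv _) mF F0).
suff -> : -%R @^-1` `]-oo, 0%R[%classic = half by [].
by apply/seteqP; split=> x /=; rewrite !in_itv/= oppr_lt0 andbT.
Qed.

Lemma L2fun_halves f : L2fun f -> L2on half f /\ L2on half (fun x => f (- x)).
Proof.
move=> Lf; have mf : cmeas f by exact: L2on_cmeas Lf.
have mh : measurable half by exact: measurable_itv.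
split; first by apply: L2onS Lf.
apply: L2onI; first exact: cmeas_opp.
have [_ [_ i]] := Lf.
have mc : measurable_fun setT (EFin \o (fun x => csq (f x))).
  by apply/measurable_EFinP; exact: measurable_csq.
apply/integrableP; split.
  by apply: measurable_funTS; apply: (measurableT_comp mc).
move/integrableP : i => [_]; apply: le_lt_trans.
under [leRHS]eq_integral do rewrite gee0_abs ?lee_fin ?csq_ge0//.
under [leLHS]eq_integral do rewrite gee0_abs ?lee_fin ?csq_ge0//.
rewrite (ge0_integral_fold mc); last by move=> x; rewrite /= lee_fin csq_ge0.
by rewrite leeDr// integral_ge0// => x _; rewrite /= lee_fin csq_ge0.
Qed.

Lemma L2fun_of_halves f : L2on half f -> L2on half (fun x => f (- x)) -> L2fun f.
Proof.
move=> Lf Lg; have mf := L2on_cmeas Lf.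
apply: (L2onI (A := setT)) => //.
have mc : measurable_fun setT (EFin \o (fun x => csq (f x))).
  by apply/measurable_EFinP; exact: measurable_csq.
apply/integrableP; split=> //.
under eq_integral do rewrite gee0_abs ?lee_fin ?csq_ge0//.
rewrite (ge0_integral_fold mc); last by move=> x; rewrite /= lee_fin csq_ge0.
have [_ [_ i]] := Lf; have [_ [_ j]] := Lg.
have mh : measurable half by exact: measurable_itv.
rewrite lte_add_pinfty//.
  by have := integrable_fin_num mh i;
    rewrite ge0_fin_numE// integral_ge0// => x _; rewrite lee_fin csq_ge0.
by have := integrable_fin_num mh j;
    rewrite ge0_fin_numE// integral_ge0// => x _; rewrite lee_fin csq_ge0.
Qed.

Lemma L2sq_fold f : L2fun f ->
  L2sq f = L2sqon half f + L2sqon half (fun x => f (- x)).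
Proof.
move=> Lf; have [[m1 [m2 i]] [_ [_ j]]] := L2fun_halves Lf.
have mc : measurable_fun setT (EFin \o (fun x => csq (f x))).
  by apply/measurable_EFinP; exact: measurable_csq.
have mh : measurable half by exact: measurable_itv.
rewrite /L2sq /L2sqon /Rintegral (ge0_integral_fold mc); last first.
  by move=> x; rewrite /= lee_fin csq_ge0.
by rewrite fineD//; exact: integrable_fin_num.
Qed.

Lemma cint_left g (x : R) : cmeas g ->
  cint `]0, x[ (fun y => g (- y)) = cint `](- x), 0[ g.
Proof.
move=> mg; rewrite -(cint_reflect (measurable_itv _) mg).
by rewrite opp_preimage_itvbndbnd opprK oppr0.
Qed.

(** Both half-lines become []0, +oo[]; reflection changes the sign of the derivative. The local
    integrability contained in [primitive] follows from [g] being square integrable. *)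
Lemma H1sP psi g ap am : H1s psi g ap am <->
  [/\ L2fun psi, L2fun g, primitive psi g ap &
      primitive (fun x => psi (- x)) (fun x => - g (- x)) am].
Proof.
have mX (X : R) : measurable (`]0%R, X[%classic : set (measurableTypeR R)) by [].
split=> [[Lp [Lg [Hp Hm]]]|[Lp Lg [_ Hp] [_ Hm]]].
  have [L1 L2] := L2fun_halves Lg; split=> //.
    by split=> // x x0; exact: L2on_cintegrable.
  have iN x : cintegrable `]0, x[ (fun y => - 1 * g (- y)).
    by apply: cintegrableZ => //; exact: L2on_cintegrable.
  split=> [x x0|x x0].
    by apply: eq_cintegrable (iN x) => // y _; rewrite mulN1r.
  rewrite Hm ?oppr_lt0// -cint_left; last exact: L2on_cmeas L1.
  congr (_ + _); rewrite -mulN1r -cintZ//; last exact: L2on_cintegrable.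
  by apply: eq_cint => y _; rewrite mulN1r.
have [L1 L2] := L2fun_halves Lg; split=> //; split=> //; split=> // x x0.
have := Hm (- x); rewrite opprK oppr_gt0 => /(_ x0) ->; congr (_ + _).
rewrite -[in RHS](opprK x) -cint_left; last exact: L2on_cmeas L1.
rewrite -[RHS]mulN1r -cintZ//; last exact: L2on_cintegrable.
by apply: eq_cint => y _; rewrite mulN1r.
Qed.

(** The value at [0] is [v 0], an immaterial choice: [H1s] constrains the function pointwise only
    away from [0]. *)
Definition join_halves u v (x : R) : C := if 0 < x then u x else v (- x).

Lemma join_halves_pos u v x : 0 < x -> join_halves u v x = u x.
Proof. by rewrite /join_halves => ->. Qed.

Lemma join_halves_neg u v x : 0 < x -> join_halves u v (- x) = v x.
Proof. by move=> x0; rewrite /join_halves oppr_gt0 ltNge ltW//= opprK. Qed.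

Lemma eq_L2on_half u v : cmeas v -> (forall x, 0 < x -> u x = v x) ->
  L2on half u -> L2on half v.
Proof.
move=> mv uv [_ [_ i]]; apply: L2onI => //; apply: eq_integrable i => //.
by move=> x; rewrite inE /= in_itv/= andbT => /uv ->.
Qed.

Lemma L2fun_join_halves u v : L2on half u -> L2on half v -> L2fun (join_halves u v).
Proof.
move=> Lu Lv.
have mg : cmeas (join_halves u v).
  apply: cmeas_if; [exact: measurable_fun_ltr|exact: L2on_cmeas Lu|].
  by apply: cmeas_opp; exact: L2on_cmeas Lv.
apply: L2fun_of_halves.
  by apply: eq_L2on_half Lu => // x x0; rewrite join_halves_pos.
apply: eq_L2on_half Lv; first exact: cmeas_opp.
by move=> x x0; rewrite join_halves_neg.
Qed.

Lemma L2funD f g : L2fun f -> L2fun g -> L2fun (fun x => f x + g x).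
Proof. exact: (L2onD (A := setT)). Qed.

Lemma L2funZ (c : C) f : L2fun f -> L2fun (fun x => c * f x).
Proof. exact: (L2onZ (A := setT)). Qed.

Lemma L2sqZ (c : C) f : L2fun f -> L2sq (fun x => c * f x) = csq c * L2sq f.
Proof. exact: (L2sqonZ (A := setT)). Qed.

Lemma L2sqD_le f g : L2fun f -> L2fun g ->
  L2sq (fun x => f x + g x) <= 2 * L2sq f + 2 * L2sq g.
Proof. exact: (L2sqonD_le (A := setT)). Qed.

Lemma L2sq_ge0 f : 0 <= L2sq f.
Proof. exact: L2sqon_ge0. Qed.

End FullLine.

(** * Interface conditions in terms of the traces of [p] and [q] *)

Section TransmissionProblem.
Context {R : realType}.
Local Notation C := R[i].
Local Notation leb := (@lebesgue_measure R).
Local Notation half := (`]0, +oo[%classic : set (measurableTypeR R)).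
Implicit Types (u v h : R -> C).
Local Notation iC := (@iC R).

Lemma iC2 : iC * iC = -1.
Proof. by apply: complex_eq; rewrite ?cReM ?cImM /=; ring. Qed.

Lemma iC_neq0 : iC != 0.
Proof.
by apply/eqP => i0; have := iC2; rewrite i0 mul0r => /eqP; rewrite eq_sym oppr_eq0 oner_eq0.
Qed.

Lemma iCV : iC^-1 = - iC.
Proof. by apply: (mulfI iC_neq0); rewrite mulfV ?iC_neq0// mulrN iC2 opprK. Qed.

Definition interface (al be ga de ap am bp bm : C) : Prop :=
  bp - bm = al * ((ap + am) / 2%:R) - iC * be * ((bp + bm) / 2%:R) /\
  ap - am = - iC * ga * ((ap + am) / 2%:R) - de * ((bp + bm) / 2%:R).

Definition transmission (k al be ga de : C) h1 h2 u1 u2 : Prop :=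
  exists ap am bp bm, [/\ H1s u1 (fun x => u2 x + h1 x) ap am,
    H1s u2 (fun x => - k ^+ 2 * u1 x + h2 x) bp bm &
    interface al be ga de ap am bp bm].

(** The expression in the hypothesis on [z], with [k] for [mu m z] and the determinant of [A]
    expanded. *)
Definition interface_det (k al be ga de : C) : C :=
  4%:R - (al * de - be * ga) + 2%:R * iC / k * al + 2%:R * iC * k * de.

(** The traces of [u1], [u2] are expressed through those of
    [p = u2 + i k u1] and [q = u2 - i k u1]. *)
Definition interface_pq (k al be ga de pp qp pm qm : C) : Prop :=
  let j := (2%:R * iC * k)^-1 in
  interface al be ga de (j * (pp - qp)) (j * (pm - qm))
    ((pp + qp) / 2%:R) ((pm + qm) / 2%:R).

Lemma linear_system2 (K : fieldType) (a11 a12 a21 a22 r1 r2 : K) :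
  let d := a11 * a22 - a12 * a21 in d != 0 -> forall x y,
  (a11 * x + a12 * y = r1 /\ a21 * x + a22 * y = r2) <->
  (x = (a22 * r1 - a12 * r2) / d /\ y = (a11 * r2 - a21 * r1) / d).
Proof.
move=> d d0 x y; split=> [[<- <-]|[-> ->]].
  by rewrite /d in d0 *; split; field.
by rewrite /d in d0 *; split; field.
Qed.

(** The traces [qp] and [pm] belong to the growing directions and are dictated by the data; [pp] and
    [qm] are free for the decaying ones. The conditions are solved for the latter by Cramer's
    rule. *)
Lemma interface_pq_linear (k al be ga de : C) : k != 0 ->
  interface_det k al be ga de != 0 ->
  exists c11 c12 c21 c22 : C, forall pp qp pm qm,
    interface_pq k al be ga de pp qp pm qm <->
    (pp = c11 * qp + c12 * pm /\ qm = c21 * qp + c22 * pm).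
Proof.
move=> k0 D0.
have i0 := iC_neq0.
pose j := (2%:R * iC * k)^-1.
(* The [a] coefficients multiply the unknowns [pp], [qm], the [b] coefficients the known [qp], [pm],
   in the two interface conditions. *)
pose a11 := 2%:R^-1 - al * j / 2%:R + iC * be / 4%:R.
pose a12 := - 2%:R^-1 + al * j / 2%:R + iC * be / 4%:R.
pose b11 := 2%:R^-1 + al * j / 2%:R + iC * be / 4%:R.
pose b12 := - 2%:R^-1 - al * j / 2%:R + iC * be / 4%:R.
pose a21 := j + iC * ga * j / 2%:R + de / 4%:R.
pose a22 := j - iC * ga * j / 2%:R + de / 4%:R.
pose b21 := - j - iC * ga * j / 2%:R + de / 4%:R.
pose b22 := - j + iC * ga * j / 2%:R + de / 4%:R.
have d0 : a11 * a22 - a12 * a21 != 0.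
  suff -> : a11 * a22 - a12 * a21 = - iC / (8%:R * k) * interface_det k al be ga de.
    by rewrite mulf_neq0// mulf_neq0 ?oppr_eq0// invr_eq0 mulf_neq0// pnatr_eq0.
  have i2 := iC2; have jE : j = - iC / (2%:R * k).
    by rewrite /j !invfM iCV; field.
  by rewrite /a11 /a12 /a21 /a22 /interface_det jE; field: i2.
have E pp qp pm qm : interface_pq k al be ga de pp qp pm qm <->
    (a11 * pp + a12 * qm = - (b11 * qp + b12 * pm) /\
     a21 * pp + a22 * qm = - (b21 * qp + b22 * pm)).
  rewrite /interface_pq /interface -/j; split=> -[e1 e2].
    split.
      apply/eqP; rewrite -subr_eq0; move/eqP: e1; rewrite -subr_eq0 => /eqP <-.
      by apply/eqP; rewrite /a11 /a12 /b11 /b12; field.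
    apply/eqP; rewrite -subr_eq0; move/eqP: e2; rewrite -subr_eq0 => /eqP <-.
    by apply/eqP; rewrite /a21 /a22 /b21 /b22; field.
  split.
    apply/eqP; rewrite -subr_eq0; move/eqP: e1; rewrite -subr_eq0 => /eqP <-.
    by apply/eqP; rewrite /a11 /a12 /b11 /b12; field.
  apply/eqP; rewrite -subr_eq0; move/eqP: e2; rewrite -subr_eq0 => /eqP <-.
  by apply/eqP; rewrite /a21 /a22 /b21 /b22; field.
pose d := a11 * a22 - a12 * a21.
exists ((a12 * b21 - a22 * b11) / d), ((a12 * b22 - a22 * b12) / d),
  ((a21 * b11 - a11 * b21) / d), ((a21 * b12 - a11 * b22) / d) => pp qp pm qm.
rewrite E linear_system2// -/d.
have -> : (a22 * - (b11 * qp + b12 * pm) - a12 * - (b21 * qp + b22 * pm)) / d =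
  (a12 * b21 - a22 * b11) / d * qp + (a12 * b22 - a22 * b12) / d * pm by ring.
have -> // : (a11 * - (b21 * qp + b22 * pm) - a21 * - (b11 * qp + b12 * pm)) / d =
  (a21 * b11 - a11 * b21) / d * qp + (a21 * b12 - a11 * b22) / d * pm by ring.
Qed.

End TransmissionProblem.

(** * Bound and existence for the unperturbed transmission problem *)

Section Core.
Context {R : realType}.
Local Notation C := R[i].
Local Notation leb := (@lebesgue_measure R).
Local Notation half := (`]0, +oo[%classic : set (measurableTypeR R)).
Implicit Types (u v h : R -> C).
Local Notation iC := (@iC R).

(** Only [l^2 = - k^2] matters, so [l = i k] gives [p] and [l = - i k] gives [q]. Reflection
    replaces the rate [l] by [- l]: what decays on the right grows on the left. *)
Lemma H1s_diag (k l : C) h1 h2 u1 u2 ap am bp bm : l * l = - k ^+ 2 ->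
  H1s u1 (fun x => u2 x + h1 x) ap am ->
  H1s u2 (fun x => - k ^+ 2 * u1 x + h2 x) bp bm ->
  let p x := u2 x + l * u1 x in let P x := h2 x + l * h1 x in
  primitive p (fun x => l * p x + P x) (bp + l * ap) /\
  primitive (fun x => p (- x)) (fun x => - l * p (- x) + - 1 * P (- x)) (bm + l * am).
Proof.
move=> l2 /H1sP[_ _ u1p u1m] /H1sP[_ _ u2p u2m] p P; split.
  apply: eq_primitive (primitiveD u2p (primitiveZ l u1p)) => // x _.
  by rewrite /p /P -l2; ring.
apply: eq_primitive (primitiveD u2m (primitiveZ l u1m)) => // x _.
by rewrite /p /P -l2; ring.
Qed.

Lemma csq_lincomb_le (c d x y : C) :
  csq (c * x + d * y) <= 2 * (csq c + csq d) * (csq x + csq y).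
Proof.
apply: le_trans (csqD_le _ _) _; rewrite !csqM -subr_ge0.
have -> : 2 * (csq c + csq d) * (csq x + csq y) -
  (2 * (csq c * csq x) + 2 * (csq d * csq y)) =
  2 * (csq c * csq y + csq d * csq x) by ring.
by rewrite mulr_ge0// addr_ge0// mulr_ge0// csq_ge0.
Qed.

Lemma L2sq_lincomb_le (c d : C) u v : L2fun u -> L2fun v ->
  L2sq (fun x => c * u x + d * v x) <= 2 * (csq c + csq d) * (L2sq u + L2sq v).
Proof.
move=> Lu Lv; apply: le_trans (L2sqD_le (L2funZ c Lu) (L2funZ d Lv)) _.
rewrite !L2sqZ// -subr_ge0.
have -> : 2 * (csq c + csq d) * (L2sq u + L2sq v) -
  (2 * (csq c * L2sq u) + 2 * (csq d * L2sq v)) =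
  2 * (csq c * L2sq v + csq d * L2sq u) by ring.
by rewrite mulr_ge0// addr_ge0// mulr_ge0 ?csq_ge0// L2sq_ge0.
Qed.

(** Pure arithmetic: primes mark the left half-line, [np], [nq], [nP], [nQ] are squared norms, and
    [a], [b], [c], [d] are the squared moduli of [pp], [qm], [qp], [pm]. The growth estimates bound
    [c + d], the interface then bounds [a + b], and the decay estimates follow. *)
Lemma energy_sum (k M np np' nq nq' nP nP' nQ nQ' a b c d : R) :
  0 < k -> 0 <= M -> 0 <= np' -> 0 <= nq -> 0 <= nP -> 0 <= nP' ->
  0 <= nQ -> 0 <= nQ' -> 0 <= c -> 0 <= d ->
  k * np <= a + k^-1 * nP -> k * nq' <= b + k^-1 * nQ' ->
  c + k * nq <= k^-1 * nQ -> d + k * np' <= k^-1 * nP' ->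
  a + b <= M * (c + d) ->
  np + np' + (nq + nq') <= (M + 1) * k^-1 ^+ 2 * (nP + nP' + (nQ + nQ')).
Proof.
move=> k0 M0 np0 nq0 nP0 nP'0 nQ0 nQ'0 c0 d0 d1 d2 g1 g2 S1.
have i0 : 0 <= k^-1 by rewrite invr_ge0 ltW.
have cd : M * (c + d) <= M * (k^-1 * (nP + nP' + (nQ + nQ'))).
  apply: ler_wpM2l => //.
  have := mulr_ge0 i0 nP0; have := mulr_ge0 i0 nQ'0.
  have := mulr_ge0 (ltW k0) np0; have := mulr_ge0 (ltW k0) nq0; lra.
rewrite (_ : (M + 1) * k^-1 ^+ 2 * _ =
  k^-1 * ((M + 1) * (k^-1 * (nP + nP' + (nQ + nQ'))))); last by ring.
rewrite ler_pdivlMl//; lra.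
Qed.

Section Diagonalization.
Context (k al be ga de : C) (k0 : 0 < Im k)
  (D0 : interface_det k al be ga de != 0).

Let kneq0 : k != 0.
Proof. by apply/eqP => k00; move: k0; rewrite k00 /= ltxx. Qed.

Let l : C := iC * k.
Let Rel : Re l = - Im k. Proof. by rewrite /l cReM /=; ring. Qed.
Let RelN : Re (- l) = Im k. Proof. by rewrite cReN Rel opprK. Qed.
Let l2 : l * l = - k ^+ 2. Proof. by have i2 := @iC2 R; rewrite /l; ring: i2. Qed.
Let lN2 : - l * - l = - k ^+ 2. Proof. by rewrite mulrNN. Qed.
Let lneq0 : l != 0. Proof. by rewrite mulf_neq0// iC_neq0. Qed.
Let j : C := (2%:R * iC * k)^-1.
Let jl : j = (2%:R * l)^-1. Proof. by rewrite /j /l mulrA. Qed.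

(** The constant depends on [k] and the interface coefficients alone, none of which involves the
    speed [c]. All uniformity in [c] comes from here. *)
Lemma transmission_bound : exists2 K : R, 0 <= K &
  forall h1 h2 u1 u2, L2fun h1 -> L2fun h2 ->
  transmission k al be ga de h1 h2 u1 u2 ->
  L2sq u1 + L2sq u2 <= K * (L2sq h1 + L2sq h2).
Proof.
have [c11 [c12 [c21 [c22 Hc]]]] := interface_pq_linear kneq0 D0.
(* [M] is the cost of the interface, [K1] of the energy estimates, [K2] of passing from [h1], [h2]
   to [P], [Q], and [K3] of returning from [p], [q] to [u1], [u2]. *)
pose M := 2 * (csq c11 + csq c12) + 2 * (csq c21 + csq c22).
pose K1 := (M + 1) * (Im k)^-1 ^+ 2.
pose K2 := 2 * (csq 1 + csq l) + 2 * (csq 1 + csq (- l)).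
pose K3 := 2 * (csq j + csq (- j)) + 2 * (csq (2%:R^-1 : C) + csq (2%:R^-1 : C)).
have c0 (x : C) : 0 <= csq x := csq_ge0 x.
have c2 (x y : C) : 0 <= 2 * (csq x + csq y) by rewrite mulr_ge0// addr_ge0.
have M0 : 0 <= M by rewrite addr_ge0.
have K10 : 0 <= K1 by rewrite mulr_ge0 ?addr_ge0// exprn_ge0// invr_ge0 ltW.
have K20 : 0 <= K2 by rewrite addr_ge0.
have K30 : 0 <= K3 by rewrite addr_ge0.
exists (K3 * (K1 * K2)); first by apply: mulr_ge0 => //; exact: mulr_ge0.
move=> h1 h2 u1 u2 Lh1 Lh2 [ap [am [bp [bm [H1 H2 If]]]]].
have [pr pl] := H1s_diag l2 H1 H2; have [qr ql] := H1s_diag lN2 H1 H2.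
have /H1sP[Lu1 _ _ _] := H1; have /H1sP[Lu2 _ _ _] := H2.
set p := fun x => u2 x + l * u1 x in pr pl.
set q := fun x => u2 x + - l * u1 x in qr ql.
set P := fun x => h2 x + l * h1 x in pr pl.
set Q := fun x => h2 x + - l * h1 x in qr ql.
have Lp : L2fun p by apply: L2funD => //; exact: L2funZ.
have Lq : L2fun q by apply: L2funD => //; exact: L2funZ.
have LP : L2fun P by apply: L2funD => //; exact: L2funZ.
have LQ : L2fun Q by apply: L2funD => //; exact: L2funZ.
have [Lpr Lpl] := L2fun_halves Lp; have [Lqr Lql] := L2fun_halves Lq.
have [LPr LPl] := L2fun_halves LP; have [LQr LQl] := L2fun_halves LQ.
have mh : measurable half by exact: measurable_itv.
have csqN1 : csq (- 1 : C) = 1 by rewrite csqN csq1.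
have [_ d1] := decay_bound k0 Rel pr (L2on_cmeas Lpr) LPr.
have g1 := growth_bound k0 RelN qr Lqr LQr.
have g2 := growth_bound k0 RelN pl Lpl (L2onZ (- 1) mh LPl).
rewrite opprK in ql.
have [_ d2] := decay_bound k0 Rel ql (L2on_cmeas Lql) (L2onZ (- 1) mh LQl).
rewrite L2sqonZ// csqN1 mul1r in g2; rewrite L2sqonZ// csqN1 mul1r in d2.
set pp := bp + l * ap in pr d1 g1 g2 d2.
set pm := bm + l * am in pl d1 g1 g2 d2.
set qp := bp + - l * ap in qr d1 g1 g2 d2.
set qm := bm + - l * am in ql d1 g1 g2 d2.
have /Hc[epp eqm] : interface_pq k al be ga de pp qp pm qm.
  rewrite /interface_pq -/j jl.
  have -> : (2%:R * l)^-1 * (pp - qp) = ap by rewrite /pp /qp; field.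
  have -> : (2%:R * l)^-1 * (pm - qm) = am by rewrite /pm /qm; field.
  have -> : (pp + qp) / 2%:R = bp by rewrite /pp /qp; field.
  by have -> : (pm + qm) / 2%:R = bm by rewrite /pm /qm; field.
have S1 : csq pp + csq qm <= M * (csq qp + csq pm).
  by rewrite epp eqm /M mulrDl lerD// csq_lincomb_le.
have T1 : L2sq p + L2sq q <= K1 * (L2sq P + L2sq Q).
  rewrite !L2sq_fold// /K1.
  by apply: (energy_sum k0 M0 _ _ _ _ _ _ _ _ d1 d2 g1 g2 S1);
    exact: L2sqon_ge0 || exact: csq_ge0.
have T2 : L2sq P + L2sq Q <= K2 * (L2sq h1 + L2sq h2).
  rewrite /K2 mulrDl [L2sq h1 + _]addrC; apply: lerD.
    have := L2sq_lincomb_le 1 l Lh2 Lh1.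
    by congr (L2sq _ <= _); apply/funext => x; rewrite mul1r.
  have := L2sq_lincomb_le 1 (- l) Lh2 Lh1.
  by congr (L2sq _ <= _); apply/funext => x; rewrite mul1r.
have T3 : L2sq u1 + L2sq u2 <= K3 * (L2sq p + L2sq q).
  rewrite /K3 mulrDl; apply: lerD.
    have := L2sq_lincomb_le j (- j) Lp Lq.
    by congr (L2sq _ <= _); apply/funext => x; rewrite jl /p /q; field.
  have := L2sq_lincomb_le (2%:R^-1) (2%:R^-1) Lp Lq.
  by congr (L2sq _ <= _); apply/funext => x; rewrite /p /q; field.
rewrite -mulrA; apply: le_trans T3 _; rewrite ler_wpM2l//.
by rewrite -mulrA; apply: le_trans T1 _; rewrite ler_wpM2l.
Qed.

(** The order of choices matters: the growing solutions come first and fix [qp] and [pm], the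
    interface then prescribes [pp] and [qm], and decaying solutions exist with any prescribed
    trace. *)
Lemma transmission_exists h1 h2 : L2fun h1 -> L2fun h2 ->
  exists u1 u2, transmission k al be ga de h1 h2 u1 u2.
Proof.
move=> Lh1 Lh2.
have [c11 [c12 [c21 [c22 Hc]]]] := interface_pq_linear kneq0 D0.
pose P x := h2 x + l * h1 x; pose Q x := h2 x + - l * h1 x.
have LP : L2fun P by apply: L2funD => //; exact: L2funZ.
have LQ : L2fun Q by apply: L2funD => //; exact: L2funZ.
have [LPr LPl] := L2fun_halves LP; have [LQr LQl] := L2fun_halves LQ.
have mh : measurable half by exact: measurable_itv.
have [qr [qp [Lqr Hqr]]] := growth_exists k0 RelN LQr.
have [pl [pm [Lpl Hpl]]] := growth_exists k0 RelN (L2onZ (- 1) mh LPl).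
pose pp := c11 * qp + c12 * pm; pose qm := c21 * qp + c22 * pm.
have [pr [Lpr Hpr]] := decay_exists pp k0 Rel LPr.
have [ql [Lql Hql]] := decay_exists qm k0 Rel (L2onZ (- 1) mh LQl).
have If : interface_pq k al be ga de pp qp pm qm by apply/Hc.
pose u1 := join_halves (fun x => j * pr x + - j * qr x) (fun x => j * pl x + - j * ql x).
pose u2 := join_halves (fun x => 2%:R^-1 * pr x + 2%:R^-1 * qr x)
  (fun x => 2%:R^-1 * pl x + 2%:R^-1 * ql x).
have L2lin (c d : C) f g : L2on half f -> L2on half g ->
    L2on half (fun x => c * f x + d * g x).
  by move=> Lf Lg; exact: L2onD mh (L2onZ c mh Lf) (L2onZ d mh Lg).
have Lu1 : L2fun u1 := L2fun_join_halves (L2lin _ _ _ _ Lpr Lqr) (L2lin _ _ _ _ Lpl Lql).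
have Lu2 : L2fun u2 := L2fun_join_halves (L2lin _ _ _ _ Lpr Lqr) (L2lin _ _ _ _ Lpl Lql).
exists u1, u2, (j * (pp - qp)), (j * (pm - qm)), ((pp + qp) / 2%:R), ((pm + qm) / 2%:R).
split; last exact: If.
- apply/H1sP; split; [exact: Lu1|exact: L2funD Lu2 Lh1| |].
    have := primitiveD (primitiveZ j Hpr) (primitiveZ (- j) Hqr).
    rewrite (_ : j * pp + - j * qp = j * (pp - qp)); last by ring.
    apply: eq_primitive => x x0; first by rewrite /u1 join_halves_pos.
    by rewrite /u2 join_halves_pos// jl /P /Q; field.
  have := primitiveD (primitiveZ j Hpl) (primitiveZ (- j) Hql).
  rewrite (_ : j * pm + - j * qm = j * (pm - qm)); last by ring.
  apply: eq_primitive => x x0; first by rewrite /u1 join_halves_neg.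
  by rewrite /u2 join_halves_neg// jl /P /Q; field.
- apply/H1sP; split; [exact: Lu2|exact: L2funD (L2funZ _ Lu1) Lh2| |].
    have := primitiveD (primitiveZ 2%:R^-1 Hpr) (primitiveZ 2%:R^-1 Hqr).
    rewrite (_ : 2%:R^-1 * pp + 2%:R^-1 * qp = (pp + qp) / 2%:R); last by field.
    apply: eq_primitive => x x0; first by rewrite /u2 join_halves_pos.
    by rewrite /u1 join_halves_pos// -l2 jl /P /Q; field.
  have := primitiveD (primitiveZ 2%:R^-1 Hpl) (primitiveZ 2%:R^-1 Hql).
  rewrite (_ : 2%:R^-1 * pm + 2%:R^-1 * qm = (pm + qm) / 2%:R); last by field.
  apply: eq_primitive => x x0; first by rewrite /u2 join_halves_neg.
  by rewrite /u1 join_halves_neg// -l2 jl /P /Q; field.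
Qed.

End Diagonalization.
End Core.

(** * Perturbation of the transmission problem *)

Section AlmostEverywhere.
Context {R : realType}.
Local Notation C := R[i].
Local Notation leb := (@lebesgue_measure R).
Implicit Types (u v f : R -> C).
Import HBNNSimple.

Lemma ae_imp (P Q : R -> Prop) : {ae leb, forall x, P x} ->
  (forall x, P x -> Q x) -> {ae leb, forall x, Q x}.
Proof. by move=> [N [mN N0 sN]] PQ; exists N; split=> // x nQ; apply: sN => /PQ. Qed.

Lemma ae_imp2 (P Q S : R -> Prop) : {ae leb, forall x, P x} ->
  {ae leb, forall x, Q x} -> (forall x, P x -> Q x -> S x) ->
  {ae leb, forall x, S x}.
Proof.
move=> [N [mN N0 sN]] [M [mM M0 sM]] PQS; exists (N `|` M); split.
- exact: measurableU.
- exact: null_set_setU.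
- move=> x /= nS; apply: contrapT => /not_orP[nN nM]; apply: nS; apply: PQS.
    by apply: contrapT => nP; apply: nN; exact: sN.
  by apply: contrapT => nQ; apply: nM; exact: sM.
Qed.

(** No measurability is assumed: the Lebesgue integral of a nonnegative
    function is the supremum over the simple functions below it. *)
Lemma ge0_ae_le_integral_lower (f1 f2 : R -> \bar R) :
  (forall x, (0 <= f1 x)%E) -> (forall x, (0 <= f2 x)%E) ->
  {ae leb, forall x, (f1 x <= f2 x)%E} ->
  (\int[leb]_x f1 x <= \int[leb]_x f2 x)%E.
Proof.
move=> f10 f20 [N [mN N0 sub]].
rewrite ge0_integralTE// [leRHS]ge0_integralTE//.
apply: ge_ereal_sup => _ [h hf1 <-]; apply: ereal_sup_ubound.
(* Cutting the simple function off on the null set places it below [f2] everywhere without changing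
   its integral. *)
exists (proj_nnsfun h (measurableC mN)).
  move=> x; rewrite /proj_nnsfun /= mindicE.
  case: (pselect (N x)) => Nx.
    by rewrite memNset ?mulr0//= => /(_ Nx).
  rewrite mem_set//= mulr1 (le_trans (hf1 x))//.
  by apply: contrapT => H; apply: Nx; exact: sub.
rewrite -!integralT_nnsfun; apply: ge0_ae_eq_integral => //.
- by apply/measurable_EFinP.
- by apply/measurable_EFinP.
- by move=> x _; rewrite lee_fin.
- by move=> x _; rewrite lee_fin.
exists N; split=> // x; apply: contra_notP => Nx _ /=.
by rewrite mindicE mem_set ?mulr1.
Qed.

(** Stated without measurability, since the right-hand side [f] of a graph is known only up to a
    null set. *)
Lemma L2sq_ae f u : {ae leb, forall x, u x = f x} -> L2sq f = L2sq u.
Proof.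
move=> fu; rewrite /L2sq /Rintegral; congr fine; apply/eqP.
rewrite eq_le !ge0_ae_le_integral_lower//;
  try (by move=> x; rewrite lee_fin csq_ge0).
  by apply: (ae_imp fu) => x ->.
by apply: (ae_imp fu) => x ->.
Qed.

Lemma L2sq_cst0 : L2sq (fun=> 0 : C) = 0.
Proof.
rewrite /L2sq; under eq_Rintegral do rewrite csq0.
by rewrite Rintegral_cst// mul0r.
Qed.

Lemma L2sq_subrr f : L2sq (fun x => f x - f x) = 0.
Proof. by rewrite -[RHS]L2sq_cst0; congr L2sq; apply/funext => x; rewrite subrr. Qed.

Lemma L2fun_cst0 : L2fun (fun=> 0 : C).
Proof.
apply: (L2onI (A := setT)); first exact: cmeas_cst.
by apply: eq_integrable (integrable0 leb setT) => // x _; rewrite csq0.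
Qed.

Lemma L2sq_le0_ae u : L2fun u -> L2sq u <= 0 -> {ae leb, forall x, u x = 0}.
Proof.
move=> Lu u0; have [_ [_ i]] := Lu.
have mu : measurable_fun setT (fun x => (csq (u x))%:E) by exact: measurable_int i.
have E : (\int[leb]_x `|(csq (u x))%:E| = 0)%E.
  under eq_integral do rewrite gee0_abs ?lee_fin ?csq_ge0//.
  rewrite -[LHS]fineK; last exact: integrable_fin_num.
  congr EFin; apply/eqP; rewrite eq_le u0/= Rintegral_ge0// => x _; exact: csq_ge0.
have /(ae_eq_integral_abs leb measurableT mu) := E.
move/ae_imp; apply=> x /(_ I) /= [ux]; apply/eqP; apply: contraT => /csq_gt0.
by rewrite ux ltxx.
Qed.

Lemma L2funB u v : L2fun u -> L2fun v -> L2fun (fun x => u x - v x).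
Proof.
move=> Lu Lv; have := L2funD Lu (L2funZ (- 1) Lv).
by congr L2fun; apply/funext => x; rewrite mulN1r.
Qed.

Lemma H1sZ (c : C) u g ap am : H1s u g ap am ->
  H1s (fun x => c * u x) (fun x => c * g x) (c * ap) (c * am).
Proof.
move=> /H1sP[Lu Lg Hp Hm]; apply/H1sP; split; [exact: L2funZ|exact: L2funZ|exact: primitiveZ|].
by apply: eq_primitive (primitiveZ c Hm) => // x _; rewrite mulrN.
Qed.

Lemma H1sB u g ap am v h bp bm : H1s u g ap am -> H1s v h bp bm ->
  H1s (fun x => u x - v x) (fun x => g x - h x) (ap - bp) (am - bm).
Proof.
move=> /H1sP[Lu Lg Hp Hm] /H1sP[Lv Lh Kp Km].
apply/H1sP; split; [exact: L2funB|exact: L2funB| |].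
  have := primitiveD Hp (primitiveZ (- 1) Kp); rewrite mulN1r.
  by apply: eq_primitive => x _; rewrite mulN1r.
have := primitiveD Hm (primitiveZ (- 1) Km); rewrite mulN1r.
by apply: eq_primitive => x _; rewrite mulN1r// opprB opprK addrC.
Qed.

Lemma transmissionB (k al be ga de : C) h1 h2 u1 u2 h1' h2' v1 v2 :
  transmission k al be ga de h1 h2 u1 u2 ->
  transmission k al be ga de h1' h2' v1 v2 ->
  transmission k al be ga de (fun x => h1 x - h1' x) (fun x => h2 x - h2' x)
    (fun x => u1 x - v1 x) (fun x => u2 x - v2 x).
Proof.
move=> [ap [am [bp [bm [H1 H2 [e1 e2]]]]]] [ap' [am' [bp' [bm' [H1' H2' [e1' e2']]]]]].
exists (ap - ap'), (am - am'), (bp - bp'), (bm - bm'); split.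
- have := H1sB H1 H1'; congr (H1s _ _ _ _); apply/funext => x; ring.
- have := H1sB H2 H2'; congr (H1s _ _ _ _); apply/funext => x; ring.
- split.
    transitivity ((bp - bm) - (bp' - bm')); first by ring.
    by rewrite e1 e1'; field.
  transitivity ((ap - am) - (ap' - am')); first by ring.
  by rewrite e2 e2'; field.
Qed.

End AlmostEverywhere.

(** * Estimates for the perturbed system, and complex square roots *)

Section Perturbation.
Context {R : realType}.
Local Notation C := R[i].
Local Notation leb := (@lebesgue_measure R).
Implicit Types (u v f : R -> C).

(** [u1' = (1 + e) u2 + b f2] and [u2' = - k^2 u1 - 2 m f1] almost everywhere;
    both graphs are instances: [e = b = 0] for [H_A], and
    [e = z / (2 m c^2)], [b = i / c] for the Dirac operator. *)
Definition perturbed (m : R) (k al be ga de e b : C) f1 f2 u1 u2 : Prop :=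
  exists F1 F2, [/\ L2fun F1, L2fun F2,
    {ae leb, forall x, F1 x = f1 x}, {ae leb, forall x, F2 x = f2 x} &
    transmission k al be ga de (fun x => e * u2 x + b * F2 x)
      (fun x => - (2%:R * m)%:C * F1 x) u1 u2].

Lemma transmission_L2fun (k al be ga de : C) h1 h2 u1 u2 :
  transmission k al be ga de h1 h2 u1 u2 -> L2fun u1 /\ L2fun u2.
Proof. by move=> [? [? [? [? [/H1sP[? _ _ _] /H1sP[? _ _ _] _]]]]]. Qed.

Lemma perturbed_L2fun m (k al be ga de e b : C) f1 f2 u1 u2 :
  perturbed m k al be ga de e b f1 f2 u1 u2 -> L2fun u1 /\ L2fun u2.
Proof. by move=> [? [? [_ _ _ _ /transmission_L2fun]]]. Qed.

Lemma perturbedB m (k al be ga de e b : C) f1 f2 u1 u2 f1' f2' v1 v2 :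
  perturbed m k al be ga de e b f1 f2 u1 u2 ->
  perturbed m k al be ga de e b f1' f2' v1 v2 ->
  perturbed m k al be ga de e b (fun x => f1 x - f1' x) (fun x => f2 x - f2' x)
    (fun x => u1 x - v1 x) (fun x => u2 x - v2 x).
Proof.
move=> [F1 [F2 [L1 L2 a1 a2 T]]] [G1 [G2 [M1 M2 c1 c2 T']]].
exists (fun x => F1 x - G1 x), (fun x => F2 x - G2 x); split.
- exact: L2funB.
- exact: L2funB.
- by apply: (ae_imp2 a1 c1) => x -> ->.
- by apply: (ae_imp2 a2 c2) => x -> ->.
- have := transmissionB T T'.
  by congr (transmission _ _ _ _ _ _ _ _ _); apply/funext => x; ring.
Qed.

(** With [e u2] moved to the right-hand side, its contribution is at most [2 K |e|^2] times the
    squared norm of [u2], hence at most half of that norm; absorbing it doubles the constant. *)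
Lemma perturbed_bound m (k al be ga de e b : C) (K : R) : 0 <= K ->
  (forall h1 h2 u1 u2, L2fun h1 -> L2fun h2 ->
    transmission k al be ga de h1 h2 u1 u2 ->
    L2sq u1 + L2sq u2 <= K * (L2sq h1 + L2sq h2)) ->
  4 * K * csq e <= 1 ->
  forall f1 f2 u1 u2, perturbed m k al be ga de e b f1 f2 u1 u2 ->
  L2sq u1 + L2sq u2 <=
    2 * K * (2 * csq b * L2sq f2 + (2 * m) ^+ 2 * L2sq f1).
Proof.
move=> K0 KB Ke f1 f2 u1 u2 [F1 [F2 [L1 L2 a1 a2 T]]].
have [Lu1 Lu2] := transmission_L2fun T.
have := KB _ _ _ _ (L2funD (L2funZ e Lu2) (L2funZ b L2)) (L2funZ _ L1) T.
rewrite (L2sq_ae a1) (L2sq_ae a2) L2sqZ// csqN csq_real.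
have := L2sqD_le (L2funZ e Lu2) (L2funZ b L2); rewrite !L2sqZ//.
move: (L2sq_ge0 u1) (L2sq_ge0 u2).
move: (L2sq u1) (L2sq u2) (L2sq F1) (L2sq F2) (L2sq _) (csq e) (csq b) Ke.
move=> n1 n2 N1 N2 H E B KE n10 n20 HE S.
have KH := ler_wpM2l K0 HE.
have En2 : 4 * K * E * n2 <= n2 by rewrite -[leRHS]mul1r ler_wpM2r.
by rewrite mulrDr in S; lra.
Qed.

(** The difference solves the unperturbed problem with [h1 = e u2 + b f2] and [h2 = 0] almost
    everywhere. Only [u2] of the perturbed solution enters the bound, and that is controlled
    uniformly. *)
Lemma perturbed_compare m (k al be ga de e b : C) (K : R) : 0 <= K ->
  (forall h1 h2 u1 u2, L2fun h1 -> L2fun h2 ->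
    transmission k al be ga de h1 h2 u1 u2 ->
    L2sq u1 + L2sq u2 <= K * (L2sq h1 + L2sq h2)) ->
  forall f1 f2 u1 u2 v1 v2, perturbed m k al be ga de e b f1 f2 u1 u2 ->
  perturbed m k al be ga de 0 0 f1 (fun=> 0) v1 v2 ->
  L2sq (fun x => u1 x - v1 x) <=
    K * (2 * csq e * L2sq u2 + 2 * csq b * L2sq f2).
Proof.
move=> K0 KB f1 f2 u1 u2 v1 v2 [F1 [F2 [L1 L2 a1 a2 T]]] [G1 [G2 [M1 M2 c1 c2 T']]].
have [Lu1 Lu2] := transmission_L2fun T; have [Lv1 Lv2] := transmission_L2fun T'.
have LH := L2funD (L2funZ e Lu2) (L2funZ b L2).
have LFG : L2fun (fun x => F1 x - G1 x) by exact: L2funB.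
have TT : transmission k al be ga de (fun x => e * u2 x + b * F2 x)
    (fun x => - (2%:R * m)%:C * (F1 x - G1 x)) (fun x => u1 x - v1 x)
    (fun x => u2 x - v2 x).
  have := transmissionB T T'.
  by congr (transmission _ _ _ _ _ _ _ _ _); apply/funext => x; ring.
have := KB _ _ _ _ LH (L2funZ _ LFG) TT.
rewrite L2sqZ//.
have -> : L2sq (fun x => F1 x - G1 x) = 0.
  rewrite -L2sq_cst0; apply/esym/L2sq_ae.
  by apply: (ae_imp2 a1 c1) => x -> ->; rewrite subrr.
rewrite mulr0 addr0 (L2sq_ae a2).
have := L2sqD_le (L2funZ e Lu2) (L2funZ b L2); rewrite !L2sqZ// => HE.
have := ler_wpM2l K0 HE; have := L2sq_ge0 (fun x => u2 x - v2 x).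
rewrite !mulrA; lra.
Qed.

(** One of the two roots of [2 m z] has positive imaginary part, so [xget] does not fall back on its
    default: a real root would make [2 m z] a nonnegative real. *)
Lemma mu_spec (m : R) (z : C) : 0 < m -> ~ (Im z = 0 /\ 0 <= Re z) ->
  mu m z ^+ 2 = (2%:R * m)%:C * z /\ 0 < Im (mu m z).
Proof.
move=> m0 hz; apply: (@xgetPex _ 0
  [set w : C | w ^+ 2 = (2%:R * m)%:C * z /\ 0 < complex.Im w]).
pose w := sqrtc ((2%:R * m)%:C * z).
have w2 : w ^+ 2 = (2%:R * m)%:C * z by exact: sqr_sqrtc.
have m20 : 0 < 2%:R * m by rewrite mulr_gt0.
case: (ltgtP (Im w) 0) => Iw.
- by exists (- w); rewrite /= sqrrN cImN oppr_gt0.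
- by exists w.
- exfalso; apply: hz.
  have e1 : Im (w ^+ 2) = 2%:R * m * Im z by rewrite w2 cImM /=; ring.
  have e2 : Re (w ^+ 2) = 2%:R * m * Re z by rewrite w2 cReM /=; ring.
  rewrite expr2 cImM Iw mulr0 mul0r addr0 in e1.
  rewrite expr2 cReM Iw mulr0 subr0 in e2; split.
    by apply/eqP; move/esym/eqP: e1; rewrite mulf_eq0 gt_eqF.
  by rewrite -(pmulr_rge0 _ m20) -e2 -expr2 sqr_ge0.
Qed.

(** Take the root with [Re s >= 0]. Then [|s + 1| >= 1], and [a - 1 = (s - 1) (s + 1)]. *)
Lemma sqrt_near1 (a : C) : exists2 s, s ^+ 2 = a & csq (s - 1) <= csq (a - 1).
Proof.
have H (s : C) : s ^+ 2 = a -> 0 <= Re s -> csq (s - 1) <= csq (a - 1).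
  move=> <- s0; rewrite (_ : s ^+ 2 - 1 = (s - 1) * (s + 1)); last by ring.
  rewrite csqM ler_peMr ?csq_ge0//.
  rewrite /csq cReD cImD /= -[leLHS]addr0 lerD ?sqr_ge0//.
  by rewrite expr_ge1// ?addr_ge0// lerDr.
have e := sqr_sqrtc a.
case: (leP 0 (Re (sqrtc a))) => s0; first by exists (sqrtc a) => //; exact: H.
exists (- sqrtc a); first by rewrite sqrrN.
by apply: H; rewrite ?sqrrN// cReN oppr_ge0 ltW.
Qed.

End Perturbation.

(** * The operator graphs *)

Section Graphs.
Context {R : realType}.
Local Notation C := R[i].
Local Notation leb := (@lebesgue_measure R).
Implicit Types (u v : R -> C) (f psi g : R -> 'cV[C]_2).
Local Notation iC := (@iC R).

Lemma forall_I2 (P : 'I_2 -> Prop) : P 0 -> P 1 -> forall i, P i.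
Proof.
move=> P0 P1 [[|[|//]] Hi].
  by rewrite (_ : Ordinal Hi = 0)//; exact: val_inj.
by rewrite (_ : Ordinal Hi = 1)//; exact: val_inj.
Qed.

Lemma mulmx22 (A : 'M[C]_2) (v : 'cV[C]_2) i :
  (A *m v) i 0 = A i 0 * v 0 0 + A i 1 * v 1 0.
Proof.
rewrite mxE big_ord_recl big_ord1.
by rewrite (_ : lift ord0 ord0 = 1)//; exact: val_inj.
Qed.

Lemma cV2P (v w : 'cV[C]_2) : v 0 0 = w 0 0 -> v 1 0 = w 1 0 -> v = w.
Proof.
by move=> e0 e1; apply/matrixP => i j; rewrite (ord1 j); move: i; apply: forall_I2.
Qed.

Lemma det_Amat (al be ga de : C) : \det (Amat al be ga de) = al * de - be * ga.
Proof.
rewrite (expand_det_row _ 0) big_ord_recl big_ord1.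
rewrite (_ : lift ord0 ord0 = 1); last exact: val_inj.
rewrite /cofactor !det_mx11 !mxE /= expr0 expr1.
ring.
Qed.

Definition col2 (a b : C) : 'cV[C]_2 := \col_(i < 2) (if val i == 0%N then a else b).

Lemma col2_0 a b : col2 a b 0 0 = a. Proof. by rewrite mxE. Qed.
Lemma col2_1 a b : col2 a b 1 0 = b. Proof. by rewrite mxE. Qed.

Lemma L2norm2 f : L2norm f =
  Num.sqrt (L2sq (fun x => f x 0 0) + L2sq (fun x => f x 1 0)).
Proof.
rewrite /L2norm big_ord_recl big_ord1.
by rewrite (_ : lift ord0 ord0 = 1)//; exact: val_inj.
Qed.

Lemma sqrt_le_scale (E X Y : R) : 0 <= E -> X <= E ^+ 2 * Y ->
  Num.sqrt X <= E * Num.sqrt Y.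
Proof.
move=> E0 XY; rewrite -[E](ger0_norm E0) -sqrtr_sqr -sqrtrM ?sqr_ge0//.
exact: ler_wsqrtr.
Qed.

Section FixedSpeed.
Context (m c : R) (al be ga de z k : C) (m0 : 0 < m) (c0 : 0 < c)
  (k2 : k ^+ 2 = (2%:R * m)%:C * z).
Let s : C := (2%:R * m * c)%:C * iC.
Let e : C := z / (2%:R * m * c ^+ 2)%:C.
Let b : C := iC / c%:C.
Let i2 : iC * iC = -1 := @iC2 R.

Let mC0 : m%:C != 0 :> C.
Proof. by rewrite eq_complex /= negb_and gt_eqF. Qed.
Let cC0 : c%:C != 0 :> C.
Proof. by rewrite eq_complex /= negb_and gt_eqF. Qed.
Let mE : (2%:R * m)%:C = 2%:R * m%:C :> C.
Proof. by rewrite rmorphM rmorph_nat. Qed.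
Let mcE : (2%:R * m * c)%:C = 2%:R * m%:C * c%:C :> C.
Proof. by rewrite !rmorphM rmorph_nat. Qed.
Let mc2E : (m * c ^+ 2)%:C = m%:C * c%:C ^+ 2 :> C.
Proof. by rewrite rmorphM rmorphXn. Qed.
Let m2c2E : (2%:R * m * c ^+ 2)%:C = 2%:R * m%:C * c%:C ^+ 2 :> C.
Proof.
have -> : 2%:R * m * c ^+ 2 = 2%:R * (m * c ^+ 2) by ring.
by rewrite rmorphM /= mc2E rmorph_nat mulrA.
Qed.

(** The scaling of [Ac] is made for this: row [0] multiplied by [m c] and row [1] multiplied by
    [- i / 2] are the two interface conditions for the traces of [psi_1] and [s psi_2]. The converse
    uses the inverse factors. *)
Lemma Dirac_boundaryP (ap am : 'cV[C]_2) :
  ((2%:R * iC) *: sigma1 - Ac m c al be ga de) *m ap =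
  ((2%:R * iC) *: sigma1 + Ac m c al be ga de) *m am <->
  interface al be ga de (ap 0 0) (am 0 0) (s * ap 1 0) (s * am 1 0).
Proof.
have E0 : forall v w : 'cV[C]_2,
    (((2%:R * iC) *: sigma1 - Ac m c al be ga de) *m v) 0 0 =
    - (al / (2%:R * m%:C * c%:C)) * v 0 0 + (2%:R * iC - be) * v 1 0 /\
    (((2%:R * iC) *: sigma1 - Ac m c al be ga de) *m v) 1 0 =
    (2%:R * iC - ga) * v 0 0 - (2%:R * m%:C * c%:C * de) * v 1 0 /\
    (((2%:R * iC) *: sigma1 + Ac m c al be ga de) *m w) 0 0 =
    al / (2%:R * m%:C * c%:C) * w 0 0 + (2%:R * iC + be) * w 1 0 /\
    (((2%:R * iC) *: sigma1 + Ac m c al be ga de) *m w) 1 0 =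
    (2%:R * iC + ga) * w 0 0 + (2%:R * m%:C * c%:C * de) * w 1 0.
  move=> v w; rewrite !mulmx22 !mxE /= mcE.
  by do !split; ring.
have [a1 [a2 [a3 a4]]] := E0 ap am.
split=> [H|[e1 e2]].
  have h0 : (((2%:R * iC) *: sigma1 - Ac m c al be ga de) *m ap) 0 0 =
    (((2%:R * iC) *: sigma1 + Ac m c al be ga de) *m am) 0 0 by rewrite H.
  have h1 : (((2%:R * iC) *: sigma1 - Ac m c al be ga de) *m ap) 1 0 =
    (((2%:R * iC) *: sigma1 + Ac m c al be ga de) *m am) 1 0 by rewrite H.
  rewrite a1 a3 in h0; rewrite a2 a4 in h1.
  split; apply/eqP; rewrite -subr_eq0.
    move/eqP: h0; rewrite -subr_eq0 => /eqP h0.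
    apply/eqP; transitivity ((m%:C * c%:C) * 0); last by rewrite mulr0.
  rewrite -h0.
    by rewrite /s mcE; field: i2; rewrite ?mC0 ?cC0.
  move/eqP: h1; rewrite -subr_eq0 => /eqP h1.
  apply/eqP; transitivity ((- iC / 2%:R) * 0); last by rewrite mulr0.
  rewrite -h1.
  by rewrite /s mcE; field: i2; rewrite ?mC0 ?cC0.
apply: cV2P; rewrite ?a1 ?a2 ?a3 ?a4; apply/eqP; rewrite -subr_eq0.
  move/eqP: e1; rewrite -subr_eq0 => /eqP e1.
  apply/eqP; transitivity ((m%:C * c%:C)^-1 * 0); last by rewrite mulr0.
  rewrite -e1.
  by rewrite /s mcE; field: i2; rewrite ?mC0 ?cC0.
move/eqP: e2; rewrite -subr_eq0 => /eqP e2.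
apply/eqP; transitivity ((2%:R * iC) * 0); last by rewrite mulr0.
  rewrite -e2.
by rewrite /s mcE; field: i2; rewrite ?mC0 ?cC0.
Qed.

(** Subtracting [m c^2] cancels the mass term in the upper component and doubles it in the lower
    one, the asymmetry behind the nonrelativistic limit. *)
Lemma Dirac_expr0 (g psi : 'cV[C]_2) :
  ((- iC * c%:C) *: (sigma1 *m g) + (m * c ^+ 2)%:C *: (sigma3 *m psi)
    - ((m * c ^+ 2)%:C + z) *: psi) 0 0 =
  - iC * c%:C * g 1 0 - z * psi 0 0.
Proof. by rewrite !(mulmx22, mxE) /=; ring. Qed.

Lemma Dirac_expr1 (g psi : 'cV[C]_2) :
  ((- iC * c%:C) *: (sigma1 *m g) + (m * c ^+ 2)%:C *: (sigma3 *m psi)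
    - ((m * c ^+ 2)%:C + z) *: psi) 1 0 =
  - iC * c%:C * g 0 0 - (2%:R * (m * c ^+ 2)%:C + z) * psi 1 0.
Proof. by rewrite !(mulmx22, mxE) /=; ring. Qed.

Lemma Dirac_graph_perturbed psi f : Dirac_graph m c (Ac m c al be ga de) z psi f ->
  perturbed m k al be ga de e b (fun x => f x 0 0) (fun x => f x 1 0)
    (fun x => psi x 0 0) (fun x => s * psi x 1 0).
Proof.
move=> [g [ap [am [H [/Dirac_boundaryP If ae]]]]].
have H0 := H 0; have H1 := H1sZ s (H 1).
have [Lp0 [Lg0 _]] := H 0; have [Lp1 [Lg1 _]] := H 1.
(* Taking the differential expressions themselves as representatives of [f] makes the system hold at
   every point, and their square integrability is inherited from [psi] and [g]. *)
exists (fun x => - iC * c%:C * g x 1 0 + - z * psi x 0 0),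
  (fun x => - iC * c%:C * g x 0 0 + - (2%:R * (m * c ^+ 2)%:C + z) * psi x 1 0).
split.
- exact: L2funD (L2funZ _ Lg1) (L2funZ _ Lp0).
- exact: L2funD (L2funZ _ Lg0) (L2funZ _ Lp1).
- by apply: (ae_imp ae) => x <-; rewrite Dirac_expr0; ring.
- by apply: (ae_imp ae) => x <-; rewrite Dirac_expr1; ring.
exists (ap 0 0), (am 0 0), (s * ap 1 0), (s * am 1 0); split=> //.
  move: H0; congr (H1s _ _ _ _); apply/funext => x.
  by rewrite /s /e /b mcE mc2E m2c2E; field: i2; rewrite mC0 cC0.
move: H1; congr (H1s _ _ _ _); apply/funext => x.
by rewrite k2 /s mcE mE; ring.
Qed.

Lemma Dirac_graph_of_system f (u1 u2 : R -> C) (ap am bp bm : C) :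
  H1s u1 (fun x => (1 + e) * u2 x + b * f x 1 0) ap am ->
  H1s u2 (fun x => - k ^+ 2 * u1 x + - (2%:R * m)%:C * f x 0 0) bp bm ->
  interface al be ga de ap am bp bm ->
  exists psi, Dirac_graph m c (Ac m c al be ga de) z psi f.
Proof.
move=> H1 H2 If.
have s0 : s != 0 by rewrite /s mcE !mulf_neq0 ?pnatr_eq0// iC_neq0.
have H2' := H1sZ s^-1 H2.
exists (fun x => col2 (u1 x) (s^-1 * u2 x)).
exists (fun x => col2 ((1 + e) * u2 x + b * f x 1 0)
  (s^-1 * (- k ^+ 2 * u1 x + - (2%:R * m)%:C * f x 0 0))),
  (col2 ap (s^-1 * bp)), (col2 am (s^-1 * bm)); split.
  apply: forall_I2; rewrite ?col2_0 ?col2_1.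
    by move: H1; congr (H1s _ _ _ _); apply/funext => x; rewrite col2_0.
  by move: H2'; congr (H1s _ _ _ _); apply/funext => x; rewrite col2_1.
split.
  by apply/Dirac_boundaryP; rewrite !col2_0 !col2_1 !mulVKf.
exists set0; split; [exact: measurable0|exact: measure0|].
move=> x /=; apply: contra_notP => _; apply: cV2P.
  rewrite Dirac_expr0 !col2_0 col2_1 k2 /s mcE mE.
  by field: i2; rewrite mC0 cC0 iC_neq0.
rewrite Dirac_expr1 !col2_0 col2_1 /s /e /b mcE mc2E m2c2E.
by field: i2; rewrite mC0 cC0 iC_neq0.
Qed.

Lemma HA_graph_perturbed (u v : R -> C) : HA_graph m al be ga de z u v ->
  exists u2, perturbed m k al be ga de 0 0 v (fun=> 0) u u2.
Proof.
move=> [g [h [ap [am [bp [bm [H1 [H2 [e1 [e2 ae]]]]]]]]]].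
have [Lu [Lg _]] := H1; have [_ [Lh _]] := H2.
exists g; exists (fun x => - (2%:R * m)%:C^-1 * h x + - z * u x), (fun=> 0); split.
- exact: L2funD (L2funZ _ Lh) (L2funZ _ Lu).
- exact: L2fun_cst0.
- by apply: (ae_imp ae) => x <-; ring.
- by exists set0; split; [exact: measurable0|exact: measure0|move=> x; apply].
exists ap, am, bp, bm; split=> //.
  by move: H1; congr (H1s _ _ _ _); apply/funext => x; rewrite !mul0r !addr0.
move: H2; congr (H1s _ _ _ _); apply/funext => x.
by rewrite k2 mE; field; rewrite mC0.
Qed.

Lemma HA_graph_of_transmission (u u2 v : R -> C) :
  transmission k al be ga de (fun=> 0) (fun x => - (2%:R * m)%:C * v x) u u2 ->
  HA_graph m al be ga de z u v.
Proof.
move=> [ap [am [bp [bm [H1 H2 [e1 e2]]]]]].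
exists u2, (fun x => - k ^+ 2 * u x + - (2%:R * m)%:C * v x), ap, am, bp, bm.
split; first by move: H1; congr (H1s _ _ _ _); apply/funext => x; rewrite addr0.
split=> //; split=> //; split=> //.
exists set0; split; [exact: measurable0|exact: measure0|].
move=> x /=; apply: contra_notP => _.
by rewrite k2 mE; field; rewrite mC0.
Qed.

End FixedSpeed.

(** With [A = |z|^2 / (2 m)^2] the two quantities are [A / c^4] and [1 / c^2]; for [c > 1] both are
    at most [(A + 1) / c], which explains [c0]. *)
Lemma small_parameters (m : R) (z : C) (eta : R) : 0 < m -> 0 < eta ->
  exists2 c0 : R, 0 < c0 & forall c, c0 < c ->
  [/\ 1 < c, csq (z / (2%:R * m * c ^+ 2)%:C) < eta & csq (iC / c%:C) < eta].
Proof.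
move=> m0 eta0.
pose A := csq z / (2%:R * m) ^+ 2.
have A0 : 0 <= A by rewrite divr_ge0 ?csq_ge0// sqr_ge0.
pose c0 := 1 + (A + 1) / eta.
have h0 : 0 < (A + 1) / eta by rewrite divr_gt0// ltr_wpDl.
exists c0 => [|c cc]; first by rewrite /c0 addr_gt0.
have c1 : 1 < c by apply: le_lt_trans cc; rewrite /c0 lerDl ltW.
have cp : 0 < c by exact: lt_trans c1.
have Ac : (A + 1) < eta * c.
  rewrite mulrC -ltr_pdivrMr//; apply: le_lt_trans cc.
  by rewrite /c0 lerDr.
have c2 : c <= c ^+ 2 by rewrite expr2 ler_peMr// ltW.
have c4 : c <= (c ^+ 2) ^+ 2.
  by rewrite (le_trans c2)// expr2 ler_peMr ?sqr_ge0// (le_trans (ltW c1)).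
split=> //.
  rewrite csqM csqV csq_real exprMn invfM mulrA -/A ltr_pdivrMr ?exprn_gt0//.
  apply: (@lt_le_trans _ _ (eta * c)); last by rewrite ler_wpM2l// ltW.
  by apply: le_lt_trans Ac; rewrite lerDl.
rewrite csqM csqV csq_real csq_iC mul1r -[X in X < _]mul1r ltr_pdivrMr ?exprn_gt0//.
apply: (@lt_le_trans _ _ (eta * c)); last by rewrite ler_wpM2l// ltW.
by apply: le_lt_trans Ac; rewrite lerDr.
Qed.

(** The substitution [w = (1 + e) u2] turns the perturbed system into the
    unperturbed one with [k], [al], [de] replaced by [s k], [s^2 al],
    [de / s^2], where [s^2 = 1 + e]. *)
Lemma perturbed_exists (k al be ga de : C) : 0 < Im k ->
  interface_det k al be ga de != 0 ->
  exists2 eta : R, 0 < eta & forall e : C, csq e < eta ->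
  forall h1 h2 : R -> C, L2fun h1 -> L2fun h2 ->
  exists u1 u2 ap am bp bm,
  [/\ H1s u1 (fun x => (1 + e) * u2 x + h1 x) ap am,
      H1s u2 (fun x => - k ^+ 2 * u1 x + h2 x) bp bm &
      interface al be ga de ap am bp bm].
Proof.
move=> k0 D0.
have kn0 : k != 0 by apply/eqP => k00; move: k0; rewrite k00 /= ltxx.
pose x1 := 4%:R - (al * de - be * ga); pose x2 := 2%:R * iC / k * al.
pose M := 2 * (csq x1 + csq x2) + csq k + 1.
have c2 : 0 <= 2 * (csq x1 + csq x2) by rewrite mulr_ge0// addr_ge0// csq_ge0.
have M0 : 0 < M by rewrite ltr_wpDl// addr_ge0 ?csq_ge0.
have D1 := csq_gt0 D0.
(* The three entries keep, in turn, the determinant nonzero, [Im (s k)] positive, and [1 + e]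
   nonzero. *)
pose eta := Num.min (Num.min (csq (interface_det k al be ga de)) (Im k ^+ 2) / M) 1.
exists eta; first by rewrite lt_min ltr01 divr_gt0// lt_min D1 exprn_gt0.
move=> e; rewrite lt_min => /andP[]; rewrite ltr_pdivlMr// lt_min => /andP[eD ek] e1.
have a0 : 1 + e != 0.
  apply/eqP => a0; have eE : e = -1 by apply/eqP; rewrite -addr_eq0 addrC a0.
  by move: e1; rewrite eE csqN csq1 ltxx.
have [s s2] := sqrt_near1 (1 + e); rewrite addrAC subrr add0r => se.
have sn0 : s != 0 by apply: contraNneq a0 => s0; rewrite -s2 s0 expr0n.
have k'0 : 0 < Im (s * k).
  rewrite (_ : s * k = k + (s - 1) * k); last by ring.
  rewrite cImD; set t := Im ((s - 1) * k).
  have : t ^+ 2 < Im k ^+ 2.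
    apply: (le_lt_trans (sqr_Im_le_csq _)); rewrite csqM.
    apply: le_lt_trans ek; apply: (@le_trans _ _ (csq e * csq k)).
      by rewrite ler_wpM2r ?csq_ge0.
    rewrite ler_wpM2l ?csq_ge0// /M -addrA addrCA lerDl addr_ge0//.
  rewrite -ltr_sqrt ?exprn_gt0// !sqrtr_sqr (gtr0_norm k0) ltr_norml => /andP[+ _].
  lra.
have D' : interface_det (s * k) ((1 + e) * al) be ga (de / (1 + e)) != 0.
  apply/eqP => D'0.
  (* Multiplied by [s], the new determinant becomes [s x1 + s^2 x2] plus the unchanged [de] term. If
     it vanished, the old one would be the difference, of squared modulus at most [|e|^2 M]. *)
  have : interface_det k al be ga de = - (s - 1) * x1 + - e * x2.
    rewrite -[LHS]subr0 -[0 in LHS](mulr0 s) -D'0 /interface_det /x1 /x2.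
    have es : e = s ^+ 2 - 1 by rewrite s2; ring.
    have s20 : 1 + (s ^+ 2 - 1) != 0 by rewrite -es.
    by rewrite es; field; rewrite kn0 sn0 s20.
  move=> DE; move: eD; rewrite DE; apply/negP; rewrite -leNgt.
  apply: le_trans (csqD_le _ _) _.
  rewrite (csqM (- (s - 1))) (csqM (- e)) !csqN.
  have h : csq (s - 1) * csq x1 <= csq e * csq x1 by rewrite ler_wpM2r ?csq_ge0.
  rewrite /M; move: h (mulr_ge0 (csq_ge0 e) (csq_ge0 k)) (csq_ge0 e).
  move: (csq x1) (csq x2) (csq k) (csq e) (csq (s - 1)) => X1 X2 Y E S h EY E0.
  rewrite !mulrDr mulr1 -subr_ge0 in h EY *; lra.
move=> h1 h2 L1 L2.
have [u1 [w [ap [am [bp [bm [H1 H2 [i1 i3]]]]]]]] :=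
  transmission_exists k'0 D' L1 (L2funZ (1 + e) L2).
exists u1, (fun x => (1 + e)^-1 * w x), ap, am, ((1 + e)^-1 * bp), ((1 + e)^-1 * bm).
split.
- by move: H1; congr (H1s _ _ _ _); apply/funext => x; rewrite mulVKf.
- have := H1sZ (1 + e)^-1 H2; congr (H1s _ _ _ _); apply/funext => x.
  by rewrite exprMn s2; field; rewrite addrC in a0 *.
- split.
    transitivity ((1 + e)^-1 * (bp - bm)); first by ring.
    by rewrite i1; field.
  by rewrite i3; field.
Qed.

End Graphs.

(** * Resolvent sets and norm convergence *)

Section Resolvents.
Context {R : realType}.
Local Notation C := R[i].
Implicit Types (f psi : R -> 'cV[C]_2).

Context (m : R) (al be ga de z k : C) (m0 : 0 < m)
  (k2 : k ^+ 2 = (2%:R * m)%:C * z) (k0 : 0 < Im k)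
  (D0 : interface_det k al be ga de != 0).

Lemma HA_in_resolvent : in_resolvent_s (HA_graph m al be ga de z).
Proof.
have [K K0 KB] := transmission_bound k0 D0.
have bound u v : HA_graph m al be ga de z u v ->
    L2sq u <= 2 * K * (2 * m) ^+ 2 * L2sq v.
  move=> /(HA_graph_perturbed m0 k2)[u2 T].
  have Ke : 4 * K * csq (0 : C) <= 1 by rewrite csq0 mulr0 ler01.
  have := perturbed_bound K0 KB Ke T; rewrite L2sq_cst0 mulr0 add0r mulrA.
  by apply: le_trans; rewrite lerDl L2sq_ge0.
split; [|split].
- move=> f Lf.
  have [u [u2 T]] := transmission_exists k0 D0 L2fun_cst0 (L2funZ (- (2%:R * m)%:C) Lf).
  by exists u; exact: (HA_graph_of_transmission m0 k2 T).
- move=> u v f /(HA_graph_perturbed m0 k2)[u2 T] /(HA_graph_perturbed m0 k2)[v2 T'].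
  have TT := perturbedB T T'; have [Lw _] := perturbed_L2fun TT.
  have Ke : 4 * K * csq (0 : C) <= 1 by rewrite csq0 mulr0 ler01.
  have := perturbed_bound K0 KB Ke TT.
  rewrite csq0 mulr0 mul0r add0r L2sq_subrr !mulr0 => S.
  have W0 : L2sq (fun x => u x - v x) <= 0.
    by apply: le_trans S; rewrite lerDl L2sq_ge0.
  by apply: (ae_imp (L2sq_le0_ae Lw W0)) => x /eqP; rewrite subr_eq0 => /eqP.
- exists (Num.sqrt (2 * K * (2 * m) ^+ 2)) => u v H.
  apply: sqrt_le_scale; first exact: sqrtr_ge0.
  rewrite sqr_sqrtr; first exact: bound.
  by rewrite mulr_ge0 ?sqr_ge0// mulr_ge0.
Qed.

Lemma Dirac_bound (K : R) (e b : C) : 0 <= K ->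
  (forall h1 h2 u1 u2, L2fun h1 -> L2fun h2 ->
    transmission k al be ga de h1 h2 u1 u2 ->
    L2sq u1 + L2sq u2 <= K * (L2sq h1 + L2sq h2)) ->
  4 * K * csq e <= 1 -> csq b <= 1 ->
  forall f1 f2 u1 u2 : R -> C, perturbed m k al be ga de e b f1 f2 u1 u2 ->
  L2sq u1 + L2sq u2 <= 2 * K * (2 + (2 * m) ^+ 2) * (L2sq f1 + L2sq f2).
Proof.
move=> K0 KB Ke b1 f1 f2 u1 u2 T; apply: le_trans (perturbed_bound K0 KB Ke T) _.
rewrite -[leRHS]mulrA; apply: ler_wpM2l; first by rewrite mulr_ge0.
have b2 : csq b * L2sq f2 <= L2sq f2 by rewrite ler_piMl// L2sq_ge0.
move: b2 (mulr_ge0 (sqr_ge0 (2 * m)) (L2sq_ge0 f2)) (L2sq_ge0 f1).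
move: (L2sq f1) (L2sq f2) (csq b) ((2 * m) ^+ 2) => n1 n2 B q b2 q2 n10.
by rewrite mulrDl !mulrDr; lra.
Qed.

(** The factor is written with [|i / c|^2] so that the smallness of [b] alone makes the lower
    component negligible. *)
Lemma lower_component (c : R) psi : 0 < c ->
  L2fun (fun x => psi x 1 0) ->
  L2sq (fun x => psi x 1 0) = ((2 * m) ^+ 2)^-1 * csq (iC / c%:C : C) *
    L2sq (fun x => (2%:R * m * c)%:C * iC * psi x 1 0).
Proof.
move=> c0 Lp; rewrite L2sqZ// !csqM !csq_iC csqV !csq_real.
by field; rewrite !gt_eqF.
Qed.

Lemma Dirac_graph_L2fun c psi f : Dirac_graph m c (Ac m c al be ga de) z psi f ->
  L2fun (fun x => psi x 0 0) /\ L2fun (fun x => psi x 1 0).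
Proof. by move=> [g [ap [am [H _]]]]; have [? _] := H 0; have [? _] := H 1. Qed.

Lemma Dirac_in_resolvent : exists c0 : R, 0 < c0 /\ forall c : R, c0 < c ->
  in_resolvent (Dirac_graph m c (Ac m c al be ga de) z).
Proof.
have [K K0 KB] := transmission_bound k0 D0.
have [eta eta0 Hex] := perturbed_exists k0 D0.
(* The entries serve existence, [|b|^2 <= 1] and [4 K |e|^2 <= 1]; the [+ 1] guards against
   [K = 0]. *)
pose eta1 := Num.min eta (Num.min 1 (4 * K + 1)^-1).
have K1 : 0 < 4 * K + 1 by rewrite ltr_wpDl// mulr_ge0.
have eta10 : 0 < eta1 by rewrite !lt_min eta0 ltr01 invr_gt0.
have [c0 c00 Hc] := small_parameters z m0 eta10.
exists c0; split=> // c /Hc[c1 he hb].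
have cp : 0 < c by exact: lt_trans c1.
move: he hb; rewrite !lt_min => /and3P[he _ he'] /and3P[_ /ltW hb _].
have Ke : 4 * K * csq (z / (2%:R * m * c ^+ 2)%:C) <= 1.
  have : (4 * K + 1) * csq (z / (2%:R * m * c ^+ 2)%:C) <= 1.
    by rewrite -ler_pdivlMl// mulr1 ltW.
  by rewrite mulrDl mul1r; have := csq_ge0 (z / (2%:R * m * c ^+ 2)%:C); lra.
set K' := 2 * K * (2 + (2 * m) ^+ 2).
have K'0 : 0 <= K' by rewrite mulr_ge0 ?addr_ge0 ?sqr_ge0// mulr_ge0.
have s0 : (2%:R * m * c)%:C * iC != 0 :> C.
  by rewrite mulf_neq0 ?iC_neq0// eq_complex /= negb_and gt_eqF// !mulr_gt0.
split; [|split].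
- move=> f Lf.
  have [u1 [u2 [ap [am [bp [bm [H1 H2 If]]]]]]] := Hex _ he _ _
    (L2funZ (iC / c%:C) (Lf 1)) (L2funZ (- (2%:R * m)%:C) (Lf 0)).
  exact: (Dirac_graph_of_system m0 cp k2 H1 H2 If).
- move=> psi1 psi2 f /(Dirac_graph_perturbed m0 cp k2) T
    /(Dirac_graph_perturbed m0 cp k2) T'.
  have TT := perturbedB T T'; have [Lw1 Lw2] := perturbed_L2fun TT.
  have := Dirac_bound K0 KB Ke hb TT.
  rewrite (L2sq_subrr (fun x => f x 0 0)) (L2sq_subrr (fun x => f x 1 0)).
  rewrite addr0 mulr0 => S.
  have W1 := L2sq_ge0 (fun x => psi1 x 0 0 - psi2 x 0 0).
  have W2 := L2sq_ge0 (fun x => (2%:R * m * c)%:C * iC * psi1 x 1 0 -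
    (2%:R * m * c)%:C * iC * psi2 x 1 0).
  have z1 := L2sq_le0_ae Lw1 (le_trans (_ : _ <= _ + _) S).
  have z2 := L2sq_le0_ae Lw2 (le_trans (_ : _ <= _ + _) S).
  apply: (ae_imp2 (z1 _) (z2 _)); rewrite ?lerDl ?lerDr//.
  move=> x /eqP; rewrite subr_eq0 => /eqP e0 /eqP.
  rewrite subr_eq0 => /eqP /(mulfI s0) e1; exact: cV2P.
- exists (Num.sqrt (K' * (1 + ((2 * m) ^+ 2)^-1))) => psi f H.
  rewrite !L2norm2; apply: sqrt_le_scale; first exact: sqrtr_ge0.
  have i0 : 0 <= ((2 * m) ^+ 2)^-1 by rewrite invr_ge0 sqr_ge0.
  rewrite sqr_sqrtr; last by rewrite mulr_ge0 ?addr_ge0.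
  have [L0 L1] := Dirac_graph_L2fun H.
  have := Dirac_bound K0 KB Ke hb (Dirac_graph_perturbed m0 cp k2 H).
  rewrite (lower_component cp L1) -/K'.
  move: (L2sq_ge0 (fun x => psi x 0 0))
    (L2sq_ge0 (fun x => (2%:R * m * c)%:C * iC * psi x 1 0)).
  move: (L2sq (fun x => psi x 0 0)) (L2sq (fun x => _ * psi x 1 0))
    (L2sq (fun x => f x 0 0) + L2sq (fun x => f x 1 0)) => n1 n2 N n10 n20 S.
  set i := ((2 * m) ^+ 2)^-1 in i0 *.
  have h1 := ler_wpM2l i0 S; rewrite mulrDr in h1.
  have h2 : i * csq (iC / c%:C : C) * n2 <= i * n2.
    by rewrite -mulrA ler_wpM2l// ler_piMl.
  have h3 := mulr_ge0 i0 n10.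
  rewrite (_ : K' * (1 + i) * N = K' * N + i * (K' * N)); last by ring.
  lra.
Qed.

Lemma Dirac_cvg (eps : R) : 0 < eps -> exists c0 : R, 0 < c0 /\ forall c : R, c0 < c ->
  forall (f psi : R -> 'cV[C]_2) (phi : R -> C), L2vec f ->
  Dirac_graph m c (Ac m c al be ga de) z psi f ->
  HA_graph m al be ga de z phi (fun x => f x 0 0) ->
  L2norm (fun x => psi x - embed1 phi x) <= eps * L2norm f.
Proof.
move=> eps0.
have [K K0 KB] := transmission_bound k0 D0.
set K' := 2 * K * (2 + (2 * m) ^+ 2).
have K'0 : 0 <= K' by rewrite mulr_ge0 ?addr_ge0 ?sqr_ge0// mulr_ge0.
have i0 : 0 <= ((2 * m) ^+ 2)^-1 by rewrite invr_ge0 sqr_ge0.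
(* Contributions to the squared error per unit of [eta]: [2 K K'] from [e u2], [2 K] from [b f2],
   and [K' / (2 m)^2] from the lower component; the [+ 1] keeps [M] positive. The threshold is then
   [eps^2 / M]. *)
pose M := 2 * (K * K') + 2 * K + ((2 * m) ^+ 2)^-1 * K' + 1.
have M0 : 0 < M by rewrite ltr_wpDl// !addr_ge0// mulr_ge0// mulr_ge0.
have K1 : 0 < 4 * K + 1 by rewrite ltr_wpDl// mulr_ge0.
pose eta1 := Num.min (eps ^+ 2 / M) (Num.min 1 (4 * K + 1)^-1).
have eta10 : 0 < eta1 by rewrite !lt_min ltr01 invr_gt0 K1 divr_gt0// exprn_gt0.
have [c0 c00 Hc] := small_parameters z m0 eta10.
exists c0; split=> // c /Hc[c1 he hb] f psi phi Lf H Hphi.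
have cp : 0 < c by exact: lt_trans c1.
move: he hb; rewrite !lt_min => /and3P[/ltW he _ he'] /and3P[/ltW hb /ltW hb1 _].
have Ke : 4 * K * csq (z / (2%:R * m * c ^+ 2)%:C) <= 1.
  have : (4 * K + 1) * csq (z / (2%:R * m * c ^+ 2)%:C) <= 1.
    by rewrite -ler_pdivlMl// mulr1 ltW.
  by rewrite mulrDl mul1r; have := csq_ge0 (z / (2%:R * m * c ^+ 2)%:C); lra.
have [L0 L1] := Dirac_graph_L2fun H.
have T := Dirac_graph_perturbed m0 cp k2 H.
have [phi2 Tphi] := HA_graph_perturbed m0 k2 Hphi.
have S := Dirac_bound K0 KB Ke hb1 T.
have S' := perturbed_compare K0 KB T Tphi.
rewrite !L2norm2; apply: sqrt_le_scale; first exact: ltW.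
have -> : (fun x => (psi x - embed1 phi x) 0 0) = (fun x => psi x 0 0 - phi x).
  by apply/funext => x; rewrite !mxE.
have -> : (fun x => (psi x - embed1 phi x) 1 0) = (fun x => psi x 1 0).
  by apply/funext => x; rewrite !mxE subr0.
rewrite (lower_component cp L1) -/K' in S *.
move: S S' (L2sq_ge0 (fun x => psi x 0 0))
  (L2sq_ge0 (fun x => (2%:R * m * c)%:C * iC * psi x 1 0)).
have f10 := L2sq_ge0 (fun x => f x 0 0); have f20 := L2sq_ge0 (fun x => f x 1 0).
move: (csq_ge0 (z / (2%:R * m * c ^+ 2)%:C)) (csq_ge0 (iC / c%:C : C)) he hb.
move: (L2sq (fun x => psi x 0 0)) (L2sq (fun x => _ * psi x 1 0)) f10 f20.
move: (L2sq (fun x => f x 0 0)) (L2sq (fun x => f x 1 0))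
  (L2sq (fun x => psi x 0 0 - phi x)).
move: (csq (z / _)) (csq (iC / c%:C : C)) => E B N1 N2 w n1 n2 N10 N20 E0 B0 hE hB S S' n10 n20.
have n2S : n2 <= K' * (N1 + N2) by lra.
have N0 : 0 <= N1 + N2 by rewrite addr_ge0.
set eta := eps ^+ 2 / M in hE hB.
have e0 : 0 <= eta by rewrite (le_trans B0).
have h1 : E * n2 <= eta * (K' * (N1 + N2)).
  exact: le_trans (ler_wpM2r n20 hE) (ler_wpM2l e0 n2S).
have h2 : B * n2 <= eta * (K' * (N1 + N2)).
  exact: le_trans (ler_wpM2r n20 hB) (ler_wpM2l e0 n2S).
have h3 : B * N2 <= eta * (N1 + N2).
  by apply: (le_trans (ler_wpM2r N20 hB)); rewrite ler_wpM2l// lerDr.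
have h4 : w <= K * (2 * (eta * (K' * (N1 + N2))) + 2 * (eta * (N1 + N2))).
  apply: le_trans S' _; apply: ler_wpM2l => //; lra.
have h5 : ((2 * m) ^+ 2)^-1 * B * n2 <= ((2 * m) ^+ 2)^-1 * (eta * (K' * (N1 + N2))).
  by rewrite -mulrA ler_wpM2l.
have h6 : eps ^+ 2 * (N1 + N2) = M * eta * (N1 + N2).
  by rewrite /eta; field; rewrite gt_eqF.
have h7 : 0 <= eta * (N1 + N2) by exact: mulr_ge0.
rewrite h6; apply: le_trans (lerD h4 h5) _; rewrite -subr_ge0 /M.
set i := ((2 * m) ^+ 2)^-1.
by rewrite [X in 0 <= X](_ : _ = eta * (N1 + N2)); last by ring.
Qed.

End Resolvents.

Theorem theorem5p1 (R : realType) (m : R) (al be ga de z : R[i]) :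
  0 < m ->
  ~ (complex.Im z = 0 /\ 0 <= complex.Re z) ->
  4%:R - \det (Amat al be ga de) + (2%:R * iC) / mu m z * al
    + 2%:R * iC * mu m z * de != 0 ->
  (* (H_A - z)^{-1} exists (implicit in the statement) *)
  in_resolvent_s (HA_graph m al be ga de z) /\
  (* for all sufficiently large c, z is in the resolvent set of
     D^{m,c}_{A_c} - m c^2 *)
  (exists c0 : R, 0 < c0 /\ forall c : R, c0 < c ->
     in_resolvent (Dirac_graph m c (Ac m c al be ga de) z)) /\
  (* norm-resolvent convergence to (1 0; 0 0) (x) (H_A - z)^{-1} *)
  (forall eps : R, 0 < eps -> exists c0 : R, 0 < c0 /\ forall c : R, c0 < c ->
     forall (f psi : R -> 'cV[R[i]]_2) (phi : R -> R[i]),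
       L2vec f ->
       Dirac_graph m c (Ac m c al be ga de) z psi f ->
       HA_graph m al be ga de z phi (fun x => f x 0 0) ->
       L2norm (fun x => psi x - embed1 phi x) <= eps * L2norm f).
Proof.
move=> m0 hz; rewrite det_Amat => D0; have [k2 k0] := mu_spec m0 hz.
split; first exact: (HA_in_resolvent m0 k2 k0 D0).
split; first exact: (Dirac_in_resolvent m0 k2 k0 D0).
by move=> eps; exact: (Dirac_cvg m0 k2 k0 D0).
Qed.
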